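(* Let $s,t>0$. For each $\alpha\in\{+,-,0\}$, $$[\mathcal L,\;K_1^\alpha+K_2^\alpha]=0\qquad\text{and}\qquad[L,\;\mathcal K_1^\alpha+\mathcal K_2^\alpha]=0,$$ where the first identity is on functions $f:\mathbb N^2\to\mathbb R$ and the second on smooth functions $f:[0,\infty)^2\to\mathbb R$. As a consequence, both $\mathcal L$ and $L$ have full $SU(1,1)$ symmetry: $\mathcal L$ commutes with every element of the algebra generated by the operators $K_1^\alpha+K_2^\alpha$, $\alpha\in\{+,-,0\}$, and $L$ commutes with every element of the algebra generated by the operators $\mathcal K_1^\alpha+\mathcal K_2^\alpha$, $\alpha\in\{+,-,0\}$.
   Context: $\mathbb N=\{0,1,2,\dots\}$; $B(s,t)=\Gamma(s)\Gamma(t)/\Gamma(s+t)$; $[A,B]=AB-BA$. Discrete generator, on functions on $\mathbb N^2$: $$\mathcal Lf(n,m)=\sum_{k=0}^n\sum_{l=0}^mr_{s,t}(n,m;k,l)\big(f(n-k+l,\;m-l+k)-f(n,m)\big),$$ $$r_{s,t}(n,m;k,l)=\frac{n!\,m!}{B(s,t)^2}\,\frac{\Gamma(k+s)\,\Gamma(m-l+t)\,\Gamma(n-k+t)\,\Gamma(l+s)}{\Gamma(s+t+n)\,\Gamma(s+t+m)\,(n-k)!\,k!\,(m-l)!\,l!}.$$ Continuous generator, on functions on $[0,\infty)^2$: $$Lf(x,y)=\int_0^1\int_0^1\big(f(x(1-u)+yv,\;y(1-v)+xu)-f(x,y)\big)\,\phi_{s,t}(u,v)\,du\,dv,$$ $$\phi_{s,t}(u,v)=\frac{1}{B(s,t)^2}\,u^{s-1}(1-u)^{t-1}v^{s-1}(1-v)^{t-1}.$$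 Discrete operators, on $f:\mathbb N\to\mathbb R$: $K^+f(n)=(s+t+n)f(n+1)$, $K^-f(n)=nf(n-1)$, $K^0f(n)=\big(\tfrac{s+t}{2}+n\big)f(n)$. They satisfy the $SU(1,1)$ commutation relations $[K^+,K^-]=2K^0$, $[K^\pm,K^0]=\pm K^\pm$. Continuous operators, on smooth $f:[0,\infty)\to\mathbb R$: $\mathcal K^+f(x)=xf(x)$, $\mathcal K^-f(x)=x f''(x)+(s+t)f'(x)$, $\mathcal K^0f(x)=xf'(x)+\tfrac{s+t}{2}f(x)$. They satisfy the same relations with opposite sign. A subscript $1$ (resp. $2$) means that the operator acts on the first (resp. second) variable of a function of two variables. The elements of the algebra generated by $K_1^\alpha+K_2^\alpha$ (resp. $\mathcal K_1^\alpha+\mathcal K_2^\alpha$) are the images under the coproduct $\Delta(K^\alpha)=K_1^\alpha+K_2^\alpha$ of elements of the universal enveloping algebra; commuting with all of them is what ''full $SU(1,1)$ symmetry'' means. *)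

(* Defs.v *)
From HB Require Import structures.
From mathcomp Require Import all_boot all_order all_algebra.
From mathcomp Require Import all_classical all_reals all_analysis.

Set Implicit Arguments.
Unset Strict Implicit.
Unset Printing Implicit Defensive.

Import Order.TTheory GRing.Theory Num.Theory.
Import numFieldNormedType.Exports.

Local Open Scope classical_set_scope.
Local Open Scope ring_scope.

Definition Gamma (R : realType) (z : R) : R :=
  \int[@lebesgue_measure R]_(x in `]0, +oo[) (x `^ (z - 1) * expR (- x)).

Definition Beta (R : realType) (s t : R) : R :=
  Gamma s * Gamma t / Gamma (s + t).

(** Operators on functions of one and of two variables. *)

Definition commutator (R : realType) (V : lmodType R) (A B : V -> V) : V -> V :=
  (A \o B) \- (B \o A).

Definition first_var (R T : Type) (K : (T -> R) -> T -> R)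
    (f : T -> T -> R) : T -> T -> R :=
  fun x y => K (f ^~ y) x.

Definition second_var (R T : Type) (K : (T -> R) -> T -> R)
    (f : T -> T -> R) : T -> T -> R :=
  fun x y => K (f x) y.

Definition coproduct (R : realType) (T : Type) (K : (T -> R) -> T -> R) :
    (T -> T -> R) -> T -> T -> R :=
  first_var K \+ second_var K.

(* The unital algebra of operators generated by G; the zero operator is
   obtained by scaling [id] by 0. *)
Inductive generated_algebra (R : realType) (V : lmodType R)
    (G : set (V -> V)) : (V -> V) -> Prop :=
| gen_base A : G A -> generated_algebra G A
| gen_id : generated_algebra G id
| gen_add A B : generated_algebra G A -> generated_algebra G B ->
    generated_algebra G (A \+ B)
| gen_scale (c : R) A : generated_algebra G A ->
    generated_algebra G (fun f => c *: A f)
| gen_comp A B : generated_algebra G A -> generated_algebra G B ->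
    generated_algebra G (A \o B).

Inductive su11 : Set := Kplus | Kminus | Kzero.

(** Discrete side: functions on nat, resp. nat * nat (curried). *)

Definition rate (R : realType) (s t : R) (n m k l : nat) : R :=
  (n`!%:R * m`!%:R) / Beta s t ^+ 2 *
  ((Gamma (k%:R + s) * Gamma ((m - l)%:R + t) *
    Gamma ((n - k)%:R + t) * Gamma (l%:R + s)) /
   (Gamma (s + t + n%:R) * Gamma (s + t + m%:R) *
    (n - k)`!%:R * k`!%:R * (m - l)`!%:R * l`!%:R)).

Definition Ldisc (R : realType) (s t : R) (f : nat -> nat -> R) :
    nat -> nat -> R :=
  fun n m => \sum_(k < n.+1) \sum_(l < m.+1)
    rate s t n m k l * (f (n - k + l)%N (m - l + k)%N - f n m).

(* For [Kminus], the value of f at 0.-1 is irrelevant: it is multiplied by 0. *)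
Definition Kdisc (R : realType) (s t : R) (a : su11) (f : nat -> R) : nat -> R :=
  match a with
  | Kplus => fun n => (s + t + n%:R) * f n.+1
  | Kminus => fun n => n%:R * f n.-1
  | Kzero => fun n => ((s + t) / 2 + n%:R) * f n
  end.

(** Continuous side.  A function on [0, +oo[ (resp. its square) is represented
    by a total function of which only the values at nonnegative arguments
    matter; derivatives are taken within [0, +oo[, hence are one-sided at 0. *)

Definition halfline_diffquot (R : realType) (g : R -> R) (x h : R) : R :=
  h^-1 * (g (x + h) - g x).

Definition halfline_nbhs (R : realType) (x : R) : set_system R :=
  within [set h | 0 <= x + h] 0^'.

Definition halfline_derivable (R : realType) (g : R -> R) (x : R) : Prop :=
  cvg (halfline_diffquot g x h @[h --> halfline_nbhs x]).

Definition halfline_derive (R : realType) (g : R -> R) (x : R) : R :=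
  lim (halfline_diffquot g x h @[h --> halfline_nbhs x]).

Definition quadrant (R : realType) : set (R * R) :=
  [set z | 0 <= z.1 /\ 0 <= z.2].

Fixpoint quadrant_Ck (R : realType) (k : nat) (f : R -> R -> R) : Prop :=
  {within @quadrant R, continuous (fun z : R * R => f z.1 z.2)} /\
  if k is k'.+1 then
    [/\ forall x y, 0 <= x -> 0 <= y ->
          halfline_derivable (f ^~ y) x /\ halfline_derivable (f x) y,
        quadrant_Ck k' (first_var (@halfline_derive R) f)
      & quadrant_Ck k' (second_var (@halfline_derive R) f)]
  else True.

Definition quadrant_smooth (R : realType) (f : R -> R -> R) : Prop :=
  forall k, quadrant_Ck k f.

Definition phi (R : realType) (s t u v : R) : R :=
  (Beta s t ^+ 2)^-1 * (u `^ (s - 1) * (1 - u) `^ (t - 1) *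
                        v `^ (s - 1) * (1 - v) `^ (t - 1)).

Definition Lcont (R : realType) (s t : R) (f : R -> R -> R) : R -> R -> R :=
  fun x y =>
  \int[@lebesgue_measure R]_(v in `]0, 1[)
    \int[@lebesgue_measure R]_(u in `]0, 1[)
      ((f (x * (1 - u) + y * v) (y * (1 - v) + x * u) - f x y) * phi s t u v).

Definition Kcont (R : realType) (s t : R) (a : su11) (f : R -> R) : R -> R :=
  match a with
  | Kplus => fun x => x * f x
  | Kminus => fun x =>
      x * halfline_derive (halfline_derive f) x + (s + t) * halfline_derive f x
  | Kzero => fun x => x * halfline_derive f x + (s + t) / 2 * f x
  end.

(* Main.v *)
(* Up to the constant total rate, both generators average [f] over a random
   exchange: in the discrete case [n] and [m] particles are split
   independently according to beta-binomial laws, in the continuous case [x]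
   and [y] are split by independent Beta variables [u] and [v].

   In the discrete case, the recurrences of the beta-binomial weights given by
   [Gamma (z + 1) = z * Gamma z] say how the average changes when a particle is
   added or removed, which is the commutation with [K^+] and [K^-]; the
   commutation with [K^0] is the conservation of [n + m].

   In the continuous case, the average is a bounded functional on continuous
   functions of [(u, v)] in the unit square, so one may differentiate under it;
   hence it preserves smoothness.  The commutation with [K^+] is the
   conservation of [x + y], and with [K^0] it is the linearity of the exchange
   in [(x, y)].  For [K^-], the defect is the average of
     [(x u (1 - u) + y v (1 - v)) (d1 - d2)^2 f
      + (s + t) (u - v) (d1 - d2) f],
   which vanishes by integrating by parts
   [u^s (1 - u)^t] and [v^s (1 - v)^t] against [(d1 - d2) f]. *)

Require Import Defs.
From mathcomp Require Import all_boot all_order all_algebra.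
From mathcomp Require Import all_classical all_reals all_analysis.
From mathcomp Require Import measurable_realfun ring lra.

Set Implicit Arguments.
Unset Strict Implicit.
Unset Printing Implicit Defensive.

Import Order.TTheory GRing.Theory Num.Theory.
Import numFieldNormedType.Exports.

Local Open Scope classical_set_scope.
Local Open Scope ring_scope.

(** * Improper integrals, Gamma and Beta *)

(** For [s < 1] or [t < 1] the densities blow up at an endpoint, and on the boundary of the closed
    quadrant only one-sided derivatives exist. These two facts shape the analysis. Integrals over an
    open interval are treated through an exhaustion by compact intervals, on each of which the
    fundamental theorem of calculus applies; integrability comes from comparison with the derivative
    of an explicit bounded function. Derivatives are taken relative to an interval, either the
    half-line or the unit segment. Differentiation under the average is proved for an arbitrary
    linear functional bounded by the supremum norm on a compact set, with the mean value theorem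
    controlling the difference quotients. The single and the iterated Beta integral are both such
    functionals. Differentiating the average in [x] or [y] creates factors such as [u] or [1 - v],
    so averages carry a continuous weight [p]; this makes the family stable under differentiation.
    Functions are constrained on the quadrant only, hence continuous identities are equalities
    there, and every operator must be shown to respect such equalities. *)

Definition exhausts (R : realType) (D : set R) (a b : nat -> R) : Prop :=
  [/\ forall n, a n < b n,
      nondecreasing_seq (fun n => `[a n, b n]%classic)
    & D = \bigcup_n `[a n, b n]%classic].

Lemma is_derive1_continuous (R : realType) (f : R -> R) (x df : R) :
  is_derive x 1 f df -> {for x, continuous f}.
Proof. by move=> [df1 _]; exact/differentiable_continuous/derivable1_diffP. Qed.

Section ImproperIntegral.
Variables (R : realType) (D : set R) (a b : nat -> R) (H h : R -> R).
Hypothesis Dab : exhausts D a b.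
Hypothesis H_derive : forall x, D x -> is_derive x 1 H (h x).
Hypothesis h_cont : forall x, D x -> {for x, continuous h}.
Notation mu := (@lebesgue_measure R).

Lemma exhausts_sub n : `[a n, b n]%classic `<=` D.
Proof. by case: Dab => _ _ -> x ?; exists n. Qed.

Lemma exhausts_measurable : measurable D.
Proof. by case: Dab => _ _ ->; exact: bigcupT_measurable. Qed.

Lemma exhausts_within n : {within `[a n, b n], continuous h}.
Proof.
by apply: continuous_in_subspaceT => x; rewrite inE => /exhausts_sub/h_cont.
Qed.

Lemma exhausts_measurable_fun : measurable_fun D h.
Proof.
have [_ _ {1}->] := Dab; apply/measurable_fun_bigcup => n //.
apply: subspace_continuous_measurable_fun => //; exact: exhausts_within.
Qed.

Lemma exhausts_FTC2 n :
  (\int[mu]_(x in `[a n, b n]) (h x)%:E = (H (b n) - H (a n))%:E)%E.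
Proof.
have [ab _ _] := Dab; have lab := ab n.
have sub x : x \in `[a n, b n] -> D x by move=> ?; exact: (@exhausts_sub n).
have cH x : x \in `[a n, b n] -> {for x, continuous H}.
  by move=> /sub/H_derive/is_derive1_continuous.
rewrite (@continuous_FTC2 _ h H) //; first exact: exhausts_within.
- split.
  + by move=> x /subset_itv_oo_cc/sub/H_derive[].
  + apply: cvg_at_right_filter; apply: cH; by rewrite in_itv/= lexx ltW.
  + apply: cvg_at_left_filter; apply: cH; by rewrite in_itv/= lexx ltW.
- by move=> x /subset_itv_oo_cc/sub/H_derive[_ <-]; rewrite derive1E.
Qed.

(** By the fundamental theorem the integrals over the compact pieces are increments of [H], hence at
    most [M + M]; monotone convergence carries the bound to [D]. *)
Lemma integrable_bounded_primitive (M : R) :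
  (forall x, D x -> 0 <= h x) -> (forall x, D x -> `|H x| <= M) ->
  mu.-integrable D (EFin \o h).
Proof.
move=> h0 HM; have [ab nd DE] := Dab.
have mh : measurable_fun D (EFin \o h).
  apply/measurable_EFinP; exact: exhausts_measurable_fun.
apply/integrableP; split => //.
under eq_integral => x xD.
  rewrite /= ger0_norm; last by apply: h0; rewrite inE in xD.
  over.
have cv : (\int[mu]_(x in `[a i, b i]) (h x)%:E @[i --> \oo] -->
    \int[mu]_(x in D) (h x)%:E)%E.
  have [_ _ {1}->] := Dab.
  apply: ge0_nondecreasing_set_cvg_integral => //.
  - move=> n; apply: measurable_funS mh; first exact: exhausts_measurable.
    exact: exhausts_sub.
  - by move=> n x /exhausts_sub/h0; rewrite lee_fin.
apply: (@le_lt_trans _ _ (M + M)%:E); last exact: ltry.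
rewrite -(cvg_lim _ cv) //; apply: lime_le; first by apply/cvg_ex; eexists; exact: cv.
apply: nearW => n; rewrite exhausts_FTC2 lee_fin.
apply: (le_trans (ler_norm _)); apply: (le_trans (ler_normB _ _)).
have [a1 a2] : D (b n) /\ D (a n).
  split; apply: (@exhausts_sub n); rewrite /= in_itv/= lexx ?ltW//.
by apply: lerD; apply: HM.
Qed.

(** Here [h] may change sign, so the passage to the limit is by dominated convergence, the
    truncations of [h] being dominated by its absolute value. *)
Lemma Rintegral_FTC2_exhausts (la lb : R) :
  mu.-integrable D (EFin \o h) ->
  H (a n) @[n --> \oo] --> la -> H (b n) @[n --> \oo] --> lb ->
  \int[mu]_(x in D) h x = lb - la.
Proof.
move=> hi Ha Hb; have [ab nd DE] := Dab.
pose hn n := (EFin \o h) \_ `[a n, b n].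
have mD := exhausts_measurable.
have subD n := @exhausts_sub n.
have mh : measurable_fun D (EFin \o h).
  apply/measurable_EFinP; exact: exhausts_measurable_fun.
have cv : (\int[mu]_(x in D) hn n x @[n --> \oo] --> \int[mu]_(x in D) (h x)%:E)%E.
  apply: (@dominated_cvg _ _ _ mu _ mD hn (EFin \o h) (abse \o (EFin \o h))).
  - move=> n; apply/measurable_restrict => //.
    apply: measurable_funS mh => //; exact: subIsetl.
  - move=> x; rewrite {1}DE => -[n _ xn].
    apply: cvg_near_cst; exists n => // m /= nm.
    rewrite /hn patchE mem_set //.
    by have /subsetPset := nd _ _ nm; exact.
  - by [].
  - exact: integrable_abse.
  - move=> n x Dx; rewrite /hn patchE; case: ifPn => // _ /=.
    by rewrite normr0 lee_fin.
rewrite /Rintegral; suff -> : (\int[mu]_(x in D) (h x)%:E = (lb - la)%:E)%E by [].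
rewrite -(cvg_lim _ cv) //; apply/cvg_lim => //.
have -> : (fun n => \int[mu]_(x in D) hn n x)%E = (fun n => (H (b n) - H (a n))%:E).
  apply/funext => n; rewrite /hn -integral_mkcondr setIC setIidl //.
  exact: exhausts_FTC2.
by apply/cvg_EFin; [exact: nearW | exact: cvgB].
Qed.

End ImproperIntegral.

(** The offset 3 gives [1 / (n + 3) < 1 / 2], so that no interval degenerates; on the half-line
    below, offset 2 suffices for the same purpose. *)
Lemma exhausts_oo01 (R : realType) :
  exhausts (`]0, 1[%classic : set R) (fun n => n.+3%:R^-1) (fun n => 1 - n.+3%:R^-1).
Proof.
have le3 (n : nat) : (n.+3%:R^-1 : R) <= 3^-1.
  by rewrite lef_pV2 ?posrE ?ltr0n // ler_nat.
have inc (m n : nat) : (m <= n)%N -> (n.+3%:R^-1 : R) <= m.+3%:R^-1.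
  by move=> mn; rewrite lef_pV2 ?posrE ?ltr0n // ler_nat.
split.
- by move=> n; have := le3 n; set z := _^-1 => ?; lra.
- move=> m n mn; apply/subsetPset => x /=; rewrite !in_itv/= => /andP[xm xn].
  have := inc _ _ mn; move: xm xn; set u := _^-1; set v := _^-1 => *.
  by apply/andP; split; lra.
- apply/seteqP; split => x /=; rewrite ?in_itv/=.
  + move=> /andP[x0 x1].
    have := @cvg_harmonic R => /cvgrPdist_lt /(_ (Num.min x (1 - x))).
    rewrite lt_min x0 subr_gt0 x1 => /(_ isT)[n _ /(_ (n.+2))].
    rewrite /= sub0r normrN ger0_norm ?invr_ge0 ?ler0n // lt_min => /(_ _)/andP[].
      by apply/leqW/leqW.
    set u := _^-1 => h1 h2; exists n => //=; rewrite in_itv/= -/u.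
    by apply/andP; split; lra.
  + move=> [n _ /=]; rewrite in_itv/= => /andP[xm xn].
    have : (0 : R) < n.+3%:R^-1 by rewrite invr_gt0 ltr0n.
    by move: xm xn; set u := _^-1 => *; apply/andP; split; lra.
Qed.

Lemma exhausts_o0y (R : realType) :
  exhausts (`]0, +oo[%classic : set R) (fun n => n.+2%:R^-1) (fun n => n.+2%:R).
Proof.
have le2 (n : nat) : (n.+2%:R^-1 : R) <= 2^-1.
  by rewrite lef_pV2 ?posrE ?ltr0n // ler_nat.
have inc (m n : nat) : (m <= n)%N -> (n.+2%:R^-1 : R) <= m.+2%:R^-1.
  by move=> mn; rewrite lef_pV2 ?posrE ?ltr0n // ler_nat.
split.
- move=> n; have := le2 n; have : (2 : R) <= n.+2%:R by rewrite ler_nat.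
  by set z := _^-1 => ? ?; lra.
- move=> m n mn; apply/subsetPset => x /=; rewrite !in_itv/= => /andP[xm xn].
  rewrite (le_trans (inc _ _ mn) xm) (le_trans xn) //.
  by rewrite ler_nat.
- apply/seteqP; split => x /=; rewrite ?in_itv/= ?andbT.
  + move=> x0; have := @cvg_harmonic R => /cvgrPdist_lt /(_ x x0)[n _ ne].
    pose k := maxn n (Num.truncn x); exists k => //=; rewrite in_itv/=.
    have /ne : (n <= k.+1)%N by rewrite leqW // leq_maxl.
    rewrite /= sub0r normrN ger0_norm ?invr_ge0 ?ler0n // => /ltW -> /=.
    apply: (le_trans (ltW (truncnS_gt x))).
    by rewrite ler_nat; apply/leqW; rewrite ltnS leq_maxr.
  + move=> [n _ /=]; rewrite in_itv/= => /andP[xm _].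
    by apply: lt_le_trans xm; rewrite invr_gt0 ltr0n.
Qed.

Section RealDerivatives.
Variables (R : realType) (x : R) (f g : R -> R) (df dg : R).
Hypotheses (Df : is_derive x 1 f df) (Dg : is_derive x 1 g dg).

Lemma is_derive1D : is_derive x 1 (fun y => f y + g y) (df + dg).
Proof. exact: is_deriveD. Qed.

Lemma is_derive1M : is_derive x 1 (fun y => f y * g y) (f x * dg + g x * df).
Proof. exact: is_deriveM. Qed.

Lemma is_derive1N : is_derive x 1 (fun y => - f y) (- df).
Proof. exact: is_deriveN. Qed.

Lemma is_derive1V : f x != 0 -> is_derive x 1 (fun y => (f y)^-1) (- (f x) ^- 2 * df).
Proof. by move=> fx; exact: (is_derive_eq (is_deriveV fx Df)). Qed.

Lemma is_derive1_cst (c : R) : is_derive x 1 (fun=> c) 0.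
Proof. exact: is_derive_cst. Qed.

End RealDerivatives.

Lemma powR_cvg (R : realType) (p x : R) : 0 < x -> y `^ p @[y --> x] --> x `^ p.
Proof. by move=> x0; exact: (is_derive1_continuous (is_derive1_powR p x0)). Qed.

Lemma powR_sub1 (R : realType) (p x : R) : 0 < x -> x `^ p = x * x `^ (p - 1).
Proof.
move=> x0; rewrite -{2}(powRr1 (ltW x0)) -powRD; first by rewrite addrCA subrr addr0.
by rewrite (gt_eqF x0) implybT.
Qed.

Lemma powR_le1 (R : realType) (p x : R) : 0 <= p -> 0 <= x -> x <= 1 -> x `^ p <= 1.
Proof.
move=> p0 x0 x1; apply: le_trans (_ : 1 `^ p <= 1); last by rewrite powR1.
by apply: ge0_ler_powR; rewrite ?nnegrE // (le_trans x0).
Qed.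

(** * The Gamma integral: convergence, positivity, functional equation *)

Section GammaFunction.
Variables (R : realType).
Implicit Types x z : R.
Notation mu := (@lebesgue_measure R).
Notation gamma_density z := (fun x : R => x `^ (z - 1) * expR (- x)).

(** This is [y <= exp y] at [y = x / (2 z)], raised to the power [z]. Only half of the exponential
    is spent, so that some decay remains against [expR (- x)]. *)
Lemma powR_le_expR z x : 0 < z -> 0 <= x -> x `^ z <= (2 * z) `^ z * expR (x / 2).
Proof.
move=> z0 x0; have z20 : 0 < 2 * z by rewrite mulr_gt0.
have -> : x / 2 = x / (2 * z) * z by field; rewrite gt_eqF.
rewrite expRM -powRM ?expR_ge0 ?(ltW z20) //.
apply: ge0_ler_powR; rewrite ?nnegrE ?(ltW z0) // ?mulr_ge0 ?expR_ge0 ?(ltW z20) //.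
rewrite ?(ltW z0) //.
rewrite mulrC -ler_pdivrMr //; apply: le_trans (expR_ge1Dx _); lra.
Qed.

Lemma gamma_density_cvg z x : 0 < x -> {for x, continuous (gamma_density z)}.
Proof.
move=> x0; apply: cvgM; first exact: powR_cvg.
apply: (@continuous_comp _ _ _ (@GRing.opp R) (@expR R)).
  exact: opp_continuous.
exact: continuous_expR.
Qed.

(* The density is dominated by a multiple of the derivative of
   [1 - (1 + x ^ z)^-1], which is bounded. *)
Lemma gamma_density_integrable z : 0 < z ->
  mu.-integrable `]0, +oo[ (EFin \o gamma_density z).
Proof.
move=> z0; pose H x := - (1 + x `^ z)^-1.
pose h x := z * x `^ (z - 1) * (1 + x `^ z) ^- 2.
have pos x : 0 < x -> 0 < 1 + x `^ z by move=> x0; rewrite addr_gt0 ?powR_gt0.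
have dH x : `]0, +oo[%classic x -> is_derive x 1 H (h x).
  rewrite /= in_itv/= andbT => x0.
  have nz : 1 + x `^ z != 0 by rewrite gt_eqF ?pos.
  apply: is_derive_eq.
    exact: (is_derive1N (is_derive1V (is_derive1D (is_derive1_cst x 1)
      (is_derive1_powR z x0)) nz)).
  by rewrite /h add0r mulNr opprK mulrC.
have ch x : `]0, +oo[%classic x -> {for x, continuous h}.
  rewrite /= in_itv/= andbT => x0.
  apply: cvgM; first by apply: cvgM; [exact: cvg_cst | exact: powR_cvg].
  apply: cvgV; first by rewrite expf_neq0 ?gt_eqF ?pos.
  by apply: cvgM; apply: cvgD; (exact: cvg_cst || exact: powR_cvg).
have ih : mu.-integrable `]0, +oo[ (EFin \o h).
  apply: (integrable_bounded_primitive (exhausts_o0y R) dH ch (M := 1)) => x;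
    rewrite /= in_itv/= andbT => x0.
    by rewrite /h !mulr_ge0 ?invr_ge0 ?exprn_ge0 ?powR_ge0 ?ltW ?pos.
  rewrite normrN ger0_norm ?invr_ge0 ?(ltW (pos _ _)) //.
  by rewrite invf_le1 ?pos // lerDl powR_ge0.
(* The quotient of the density by [h] is [(1 + x^z)^2 exp(-x) / z], and
   [1 + x^z <= (1 + (2 z)^z) exp(x / 2)] by [powR_le_expR]. *)
pose C := (1 + (2 * z) `^ z) ^+ 2 / z.
apply: (le_integrable _ _ _ (integrableZl _ C ih)) => //.
  apply/measurable_EFinP; apply: (exhausts_measurable_fun (exhausts_o0y R)) => x.
  by rewrite /= in_itv/= andbT; exact: gamma_density_cvg.
move=> x /=; rewrite in_itv/= andbT => x0.
rewrite lee_fin ger0_norm ?mulr_ge0 ?powR_ge0 ?expR_ge0 //.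
apply: le_trans (ler_norm _); rewrite /C /h.
have -> : (1 + (2 * z) `^ z) ^+ 2 / z * (z * x `^ (z - 1) * (1 + x `^ z) ^- 2) =
   x `^ (z - 1) * ((1 + (2 * z) `^ z) / (1 + x `^ z)) ^+ 2.
  by field; rewrite !gt_eqF ?pos.
rewrite ler_wpM2l ?powR_ge0 //.
have -> : expR (- x) = expR (- (x / 2)) ^+ 2.
  by rewrite expr2 -expRD; congr expR; field.
rewrite lerXn2r ?nnegrE ?expR_ge0 ?divr_ge0 ?addr_ge0 ?powR_ge0 //.
rewrite ler_pdivlMr ?pos // expRN ler_pdivrMl ?expR_gt0 //.
rewrite mulrC mulrDl mul1r lerD ?(powR_le_expR z0 (ltW x0)) //.
by apply: le_trans (expR_ge1Dx _); rewrite lerDl divr_ge0 ?ltW.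
Qed.

(** On [[1, 2]], an interval of length 1, [ln x] lies between 0 and 1, so the power is at least
    [exp(-|z - 1|)] and the exponential at least [exp(-2)]. Their product [c] is a lower bound of
    the integral. *)
Lemma Gamma_gt0 z : 0 < z -> 0 < Gamma z.
Proof.
move=> z0; pose c := expR (- `|z - 1| - 2).
have c0 : 0 < c by exact: expR_gt0.
have sub : `[1, 2]%classic `<=` (`]0, +oo[%classic : set R).
  move=> x /=; rewrite !in_itv/= => /andP[x1 _]; rewrite andbT; lra.
apply: (lt_le_trans c0).
have cE : c = \int[mu]_(x in `[1, 2]) c.
  rewrite Rintegral_cst //= lebesgue_measure_itv /= lte_fin ltr1n /=.
  ring.
have fin : (\int[mu]_(x in `]0%R, +oo[) (gamma_density z x)%:E)%E \is a fin_num.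
  exact: (integrable_fin_num _ (gamma_density_integrable z0)).
rewrite /Gamma -lee_fin fineK // cE /Rintegral fineK; last first.
  by rewrite integral_cst //= lebesgue_measure_itv /= lte_fin ltr1n.
apply: (@le_trans _ _ (\int[mu]_(x in `[1%R, 2%R]) (gamma_density z x)%:E)%E).
  apply: ge0_le_integral => //.
  - by move=> x _; rewrite lee_fin ltW.
  - apply: measurable_funS (measurable_int _ (gamma_density_integrable z0)) => //.
  - move=> x /=; rewrite in_itv/= => /andP[x1 x2].
    have x0 : 0 < x by lra.
    rewrite lee_fin /c expRD; apply: ler_pM; rewrite ?expR_ge0 //; last first.
      by rewrite ler_expR; lra.
    rewrite /powR gt_eqF // ler_expR.
    have l0 : 0 <= ln x by exact: ln_ge0.
    have l1 : ln x <= 1.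
      by have := le_ln1Dx (x := x - 1); rewrite addrCA subrr addr0; lra.
    rewrite lerNl -mulNr; apply: (le_trans (ler_norm _)).
    by rewrite normrM normrN (ger0_norm l0) ler_piMr.
apply: ge0_subset_integral => //.
- exact: (measurable_int _ (gamma_density_integrable z0)).
- by move=> x _; rewrite lee_fin mulr_ge0 ?powR_ge0 ?expR_ge0.
Qed.

(** The function [x^z exp(-x)] vanishes at both ends of the half-line, and its derivative is the
    difference of [z] times the density for [z] and the density for [z + 1]. *)
Lemma GammaD1 z : 0 < z -> Gamma (z + 1) = z * Gamma z.
Proof.
move=> z0; have z1 : 0 < z + 1 by lra.
pose H x := x `^ z * expR (- x).
pose h x := z * gamma_density z x - gamma_density (z + 1) x.
have i0 := gamma_density_integrable z0.
have i1 : mu.-integrable `]0, +oo[ (EFin \o (fun x => z * gamma_density z x)).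
  exact: (integrableZl _ z i0).
have i2 := gamma_density_integrable z1.
have dH x : `]0, +oo[%classic x -> is_derive x 1 H (h x).
  rewrite /= in_itv/= andbT => x0.
  apply: is_derive_eq.
    exact: (is_derive1M (is_derive1_powR z x0) (is_derive1_comp
      (is_derive_expR (- x)) (is_deriveN (is_derive_id x 1)))).
  rewrite /h /GRing.scale /= addrK; ring.
have ch x : `]0, +oo[%classic x -> {for x, continuous h}.
  rewrite /= in_itv/= andbT => x0.
  by apply: cvgB; [apply: cvgM; [exact: cvg_cst|]|]; exact: gamma_density_cvg.
have ih : mu.-integrable `]0, +oo[ (EFin \o h).
  exact: (integrableB _ i1 i2).
have cn : (n.+2%:R^-1 : R) @[n --> \oo] --> 0.
  by rewrite (cvg_shiftS (fun n => n.+1%:R^-1 : R)); exact: cvg_harmonic.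
have H0 : H n.+2%:R^-1 @[n --> \oo] --> 0.
  rewrite -(mul0r (expR (- 0))); apply: cvgM.
    apply: (cvg_comp _ _ _ (powR_cvg0 z0)) => A /cn.
    by case=> N _ HN; exists N => // n Nn; apply: HN => //=; rewrite invr_gt0.
  exact: (cvg_comp _ _ (cvgN cn) (@continuous_expR R (- 0))).
have Hy : H n.+2%:R @[n --> \oo] --> 0.
  (* [powR_le_expR] bounds [H y] by [(2 z)^z exp(-y / 2)], and [exp(-y / 2) <= 2 / y]. *)
  pose C := (2 * z) `^ z * 2.
  apply: (@squeeze_cvgr _ _ _ _ (fun=> 0) (fun n => C * n.+2%:R^-1)).
  - apply: nearW => n; rewrite mulr_ge0 ?powR_ge0 ?expR_ge0 //=.
    have := powR_le_expR z0 (ler0n R n.+2); rewrite /H /C.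
    set y := n.+2%:R => le; have y0 : 0 < y by rewrite ltr0n.
    have -> : expR (- y) = expR (- (y / 2)) * expR (- (y / 2)).
      by rewrite -expRD; congr expR; field.
    rewrite expRN mulrA ler_pdivrMr ?expR_gt0 // ler_pdivrMr ?expR_gt0 //.
    apply: (le_trans le); rewrite -!mulrA ler_wpM2l ?powR_ge0 //.
    rewrite mulrA mulrA ler_peMl ?expR_ge0 //.
    rewrite -ler_pdivrMl ?divr_gt0 // mulr1 invf_div.
    by apply: le_trans (expR_ge1Dx _); rewrite lerDr.
  - exact: cvg_cst.
  - by rewrite -(mulr0 C); apply: cvgM; [exact: cvg_cst|].
have := Rintegral_FTC2_exhausts (exhausts_o0y R) dH ch ih H0 Hy.
rewrite subr0 /h (RintegralB _ i1 i2) // (RintegralZl _ _ i0) //.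
by move=> /eqP; rewrite subr_eq0 => /eqP.
Qed.

End GammaFunction.

(** * The Beta density on the open unit interval *)

Definition beta_density (R : realType) (s t u : R) : R :=
  u `^ (s - 1) * (1 - u) `^ (t - 1).

Section BetaDensity.
Variables (R : realType) (s t : R).
Hypotheses (s0 : 0 < s) (t0 : 0 < t).
Notation mu := (@lebesgue_measure R).

Lemma is_derive1_onem_powR (p x : R) : x < 1 ->
  is_derive x 1 (fun u : R => (1 - u) `^ p) (- (p * (1 - x) `^ (p - 1))).
Proof.
move=> x1; have x10 : 0 < 1 - x by lra.
have dg : is_derive x 1 (fun u : R => 1 - u) (0 + - 1).
  exact: (is_derive1D (is_derive1_cst x 1) (is_derive1N (is_derive_id x 1))).
have -> : - (p * (1 - x) `^ (p - 1)) = p * (1 - x) `^ (p - 1) * (0 - 1) by ring.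
exact: (@is_derive1_comp R (fun y => y `^ p) (fun u => 1 - u) x _ _ (is_derive1_powR p x10) dg).
Qed.

Lemma beta_density_continuous (x : R) : 0 < x -> x < 1 ->
  {for x, continuous (beta_density s t)}.
Proof.
move=> x0 x1; apply: cvgM; first exact: powR_cvg.
exact: (is_derive1_continuous (is_derive1_onem_powR _ x1)).
Qed.

Lemma beta_density_ge0 (u : R) : 0 <= beta_density s t u.
Proof. by rewrite mulr_ge0 ?powR_ge0. Qed.

(* The density is dominated by a multiple of the derivative of
   [u ^ s / (u ^ s + (1 - u) ^ t)], which is bounded. *)
Lemma beta_density_integrable : mu.-integrable `]0, 1[ (EFin \o beta_density s t).
Proof.
pose S (u : R) := u `^ s + (1 - u) `^ t.
pose H u := u `^ s * (S u)^-1.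
pose h u := beta_density s t u * (s * (1 - u) + t * u) * (S u) ^- 2.
have Spos x : 0 < x -> x < 1 -> 0 < S x.
  by move=> x0 x1; rewrite addr_gt0 ?powR_gt0 //; lra.
have dH (x : R) : `]0, 1[%classic x -> is_derive x 1 H (h x).
  rewrite /= in_itv/= => /andP[x0 x1]; have nz : S x != 0 by rewrite gt_eqF ?Spos.
  have dS := is_derive1D (is_derive1_powR s x0) (is_derive1_onem_powR t x1).
  apply: is_derive_eq.
    exact: (is_derive1M (is_derive1_powR s x0) (is_derive1V dS nz)).
  move: nz; rewrite /h /beta_density /S (powR_sub1 s x0).
  rewrite (@powR_sub1 _ t (1 - x)); last lra.
  by set a := x `^ _; set b := _ `^ _ => nz; field.
have cS x : 0 < x -> x < 1 -> {for x, continuous S}.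
  move=> x0 x1.
  exact: (is_derive1_continuous (is_derive1D (is_derive1_powR s x0) (is_derive1_onem_powR t x1))).
have ch (x : R) : `]0, 1[%classic x -> {for x, continuous h}.
  rewrite /= in_itv/= => /andP[x0 x1].
  apply: cvgM.
    apply: cvgM; first exact: beta_density_continuous.
    apply: cvgD; apply: cvgM; try exact: cvg_cst; try exact: cvg_id.
    by apply: cvgB; [exact: cvg_cst|exact: cvg_id].
  apply: cvgV; first by rewrite expf_neq0 ?gt_eqF ?Spos.
  by apply: cvgM; exact: cS.
pose m := Num.min s t.
have m0 : 0 < m by rewrite lt_min s0.
have mle x : 0 < x -> x < 1 -> m <= s * (1 - x) + t * x.
  move=> x0 x1; have ms : m <= s by rewrite ge_min lexx.
  have mt : m <= t by rewrite ge_min lexx orbT.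
  by nra.
have ih : mu.-integrable `]0, 1[ (EFin \o h).
  apply: (integrable_bounded_primitive (exhausts_oo01 R) dH ch (M := 1)) => x;
    rewrite /= in_itv/= => /andP[x0 x1].
    rewrite /h !mulr_ge0 ?invr_ge0 ?exprn_ge0 ?powR_ge0 ?(ltW (Spos _ _ _)) //.
    by apply: le_trans (mle _ x0 x1); exact: ltW.
  rewrite ger0_norm; last by rewrite mulr_ge0 ?invr_ge0 ?powR_ge0 ?(ltW (Spos _ _ _)).
  by rewrite ler_pdivrMr ?Spos // mul1r lerDl powR_ge0.
(* In [h] the factor [s (1 - x) + t x] is a convex combination, hence at least [m], and [S <= 2]
   accounts for the 4. *)
pose C := 4 / m.
have le (x : R) : 0 < x -> x < 1 -> beta_density s t x <= C * h x.
  move=> x0 x1; rewrite /C /h.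
  have S0 := Spos _ x0 x1.
  have -> : 4 / m * (beta_density s t x * (s * (1 - x) + t * x) / S x ^+ 2) =
      beta_density s t x * ((4 / S x ^+ 2) * ((s * (1 - x) + t * x) / m)).
    by field; rewrite !gt_eqF.
  rewrite ler_peMr ?beta_density_ge0 //.
  rewrite mulr_ege1 //; last by rewrite ler_pdivlMr // mul1r mle.
  rewrite ler_pdivlMr ?exprn_gt0 // mul1r.
  have a1 : x `^ s <= 1 by rewrite powR_le1 // ltW.
  have b1 : (1 - x) `^ t <= 1 by apply: powR_le1; [exact: ltW | lra | lra].
  have : S x <= 2 by rewrite /S; lra.
    rewrite expr2; nra.
apply: (le_integrable _ _ _ (integrableZl _ C ih)) => //.
  apply/measurable_EFinP; apply: (exhausts_measurable_fun (exhausts_oo01 R)) => x.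
  by rewrite /= in_itv/= => /andP[]; exact: beta_density_continuous.
move=> x /=; rewrite in_itv/= => /andP[x0 x1].
rewrite lee_fin ger0_norm ?beta_density_ge0 //.
exact: le_trans (le _ x0 x1) (ler_norm _).
Qed.

End BetaDensity.

(** * The discrete process *)

Section BetaBinomial.
(* [G] is the Gamma function, of which only positivity and the functional
   equation matter. *)
Variables (R : realType) (s t : R) (G : R -> R).
Hypotheses (s0 : 0 < s) (t0 : 0 < t).
Hypothesis G_gt0 : forall z, 0 < z -> 0 < G z.
Hypothesis GD1 : forall z, 0 < z -> G (z + 1) = z * G z.

(* Probability that [k + j] particles split into [k] and [j]. *)
Definition betabin (k j : nat) : R :=
  (k + j)`!%:R / (k`!%:R * j`!%:R) * (G (k%:R + s) * G (j%:R + t)) /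
  (G (s + t + (k + j)%:R) * (G s * G t / G (s + t))).

Definition betabin_mean (n : nat) (g : nat -> nat -> R) : R :=
  \sum_(k < n.+1) betabin k (n - k) * g k (n - k)%N.

Let st0 : 0 < s + t. Proof. exact: addr_gt0. Qed.

Let G_nat_gt0 (z : R) (n : nat) : 0 < z -> 0 < G (n%:R + z).
Proof. by move=> z0; rewrite G_gt0 // ltr_wpDl. Qed.

Let G_natS (z : R) (n : nat) : 0 < z ->
  G (n.+1%:R + z) = (n%:R + z) * G (n%:R + z).
Proof. by move=> z0; rewrite -GD1 ?ltr_wpDl // -natr1 addrAC. Qed.

Let Beta_gt0 : 0 < G s * G t / G (s + t).
Proof. by rewrite divr_gt0 ?mulr_gt0 ?G_gt0. Qed.

Lemma betabin00 : betabin 0 0 = 1.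
Proof.
by rewrite /betabin addn0 fact0 !add0r addr0; field; rewrite !gt_eqF ?G_gt0.
Qed.

(** Balance relation of a Polya urn: removing a uniformly chosen particle from [k + j + 1] is
    matched with adding one to [k + j], the new particle joining the second part with probability
    [(t + j) / (s + t + k + j)]. The companion lemma treats the first part. *)
Lemma betabinSr k j :
  j.+1%:R * betabin k j.+1 = (k + j).+1%:R * (t + j%:R) / (s + t + (k + j)%:R) * betabin k j.
Proof.
rewrite /betabin addnS !factS !natrM (G_natS _ t0) !(addrC (s + t)) (G_natS _ st0).
have [h1 h2 h3] : [/\ G (k%:R + s) != 0, G (j%:R + t) != 0 &
  G ((k + j)%:R + (s + t)) != 0] by rewrite !gt_eqF ?G_nat_gt0.
have h4 : (k + j)%:R + (s + t) != 0 by rewrite gt_eqF // ltr_wpDl.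
have h5 := lt0r_neq0 Beta_gt0.
have [h6 h7 h8] : [/\ k`!%:R != 0 :> R, j`!%:R != 0 :> R & j.+1%:R != 0 :> R].
  by rewrite !pnatr_eq0 -!lt0n !fact_gt0.
move: h1 h2 h3 h4 h5 h6 h7 h8.
set a := G _; set b := G _; set c := G _; set d := _ / G (s + t).
set e := _%:R + (s + t); set x := _`!%:R; set y := _`!%:R; set z := j.+1%:R.
by move=> *; field; do ?[apply/andP; split].
Qed.

Lemma betabinSl k j :
  k.+1%:R * betabin k.+1 j = (k + j).+1%:R * (s + k%:R) / (s + t + (k + j)%:R) * betabin k j.
Proof.
rewrite /betabin addSn !factS !natrM (G_natS _ s0) !(addrC (s + t)) (G_natS _ st0).
have [h1 h2 h3] : [/\ G (k%:R + s) != 0, G (j%:R + t) != 0 &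
  G ((k + j)%:R + (s + t)) != 0] by rewrite !gt_eqF ?G_nat_gt0.
have h4 : (k + j)%:R + (s + t) != 0 by rewrite gt_eqF // ltr_wpDl.
have h5 := lt0r_neq0 Beta_gt0.
have [h6 h7 h8] : [/\ k`!%:R != 0 :> R, j`!%:R != 0 :> R & k.+1%:R != 0 :> R].
  by rewrite !pnatr_eq0 -!lt0n !fact_gt0.
move: h1 h2 h3 h4 h5 h6 h7 h8.
set a := G _; set b := G _; set c := G _; set d := _ / G (s + t).
set e := _%:R + (s + t); set x := _`!%:R; set y := _`!%:R; set z := k.+1%:R.
by move=> *; field; do ?[apply/andP; split].
Qed.

Lemma eq_betabin_mean n g h : (forall k j, (k + j = n)%N -> g k j = h k j) ->
  betabin_mean n g = betabin_mean n h.
Proof.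
move=> gh; apply: eq_bigr => k _; congr (_ * _); apply: gh.
by rewrite subnKC // -ltnS.
Qed.

Lemma betabin_meanD n g h :
  betabin_mean n (fun k j => g k j + h k j) = betabin_mean n g + betabin_mean n h.
Proof. by rewrite -big_split; apply: eq_bigr => k _; rewrite mulrDr. Qed.

Lemma betabin_meanZ n c g :
  betabin_mean n (fun k j => c * g k j) = c * betabin_mean n g.
Proof. by rewrite /betabin_mean mulr_sumr; apply: eq_bigr => k _; rewrite mulrCA. Qed.

(** Both urn recurrences, summed. The sum for [n.+1] has one more term than the sum for [n]; it
    drops out because its factor [j] or [k] is 0. Separate [g] and [h] let the identity serve
    lowering, where they shift different arguments of one function, as well as raising, where they
    coincide. *)
Lemma betabin_meanS n g h :
  betabin_mean n.+1 (fun k j => j%:R * g k j + k%:R * h k j) =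
  n.+1%:R / (s + t + n%:R) *
  betabin_mean n (fun k j => (t + j%:R) * g k j.+1 + (s + k%:R) * h k.+1 j).
Proof.
rewrite !betabin_meanD mulrDr; congr (_ + _).
- rewrite /betabin_mean big_ord_recr /= subnn mul0r mulr0 addr0 mulr_sumr.
  apply: eq_bigr => k _; have kn : (k <= n)%N by rewrite -ltnS.
  by rewrite subSn // mulrA (mulrC (betabin _ _)) betabinSr subnKC //; ring.
- rewrite /betabin_mean big_ord_recl /= mul0r mulr0 add0r mulr_sumr.
  apply: eq_bigr => k _; have kn : (k <= n)%N by rewrite -ltnS.
  rewrite /bump /= add1n subSS mulrA (mulrC (betabin _ _)) betabinSl subnKC //; ring.
Qed.

Let stn0 n : s + t + n%:R != 0.
Proof. by rewrite gt_eqF // ltr_wpDr. Qed.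

Lemma betabin_mean_lower n g :
  betabin_mean n (fun k j => j%:R * g k j.-1 + k%:R * g k.-1 j) =
  n%:R * betabin_mean n.-1 g.
Proof.
case: n => [|n].
  by rewrite /betabin_mean big_ord1 /= !mul0r addr0 mulr0.
rewrite betabin_meanS /=.
rewrite (eq_betabin_mean (h := fun k j => (s + t + n%:R) * g k j)); last first.
  by move=> k j <-; rewrite natrD; ring.
by rewrite betabin_meanZ; field; rewrite stn0.
Qed.

Lemma betabin_mean_raise n g :
  betabin_mean n (fun k j => (t + j%:R) * g k j.+1 + (s + k%:R) * g k.+1 j) =
  (s + t + n%:R) * betabin_mean n.+1 g.
Proof.
(* With this factor the left side becomes the right side of [betabin_meanS] for [h = g], whose other
   side has total coefficient [j + k = n.+1]. *)
apply: (@mulfI _ (n.+1%:R / (s + t + n%:R))).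
  by rewrite mulf_neq0 ?invr_eq0 ?stn0 ?pnatr_eq0.
rewrite -betabin_meanS (eq_betabin_mean (h := fun k j => n.+1%:R * g k j)).
  by rewrite betabin_meanZ; field; rewrite stn0.
by move=> k j <-; rewrite natrD; ring.
Qed.

(** Raising the constant 1 shows that the total masses for [n] and [n.+1] particles are equal;
    induction starts from [betabin00]. *)
Lemma betabin_mean1 n : betabin_mean n (fun _ _ => 1) = 1.
Proof.
elim: n => [|n IH].
  by rewrite /betabin_mean big_ord1 /= betabin00 mulr1.
have := betabin_mean_raise n (fun _ _ => 1).
rewrite (eq_betabin_mean (h := fun k j => (s + t + n%:R) * 1)); last first.
  by move=> k j <-; rewrite natrD; ring.
by rewrite betabin_meanZ IH => /(mulfI (stn0 n)).
Qed.

(** Of the [n] particles, [j] stay and [k] move to the second site; of the [m] particles, [i] stay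
    and [l] move to the first. *)
Definition redistribute (f : nat -> nat -> R) (n m : nat) : R :=
  betabin_mean n (fun k j => betabin_mean m (fun l i => f (j + l)%N (i + k)%N)).

(** A particle created at the first site joins either the [j] that stayed or the [l] that arrived,
    and [s + t + (j + l) = (t + j) + (s + l)] splits the coefficient accordingly; likewise at the
    second site. The four terms are then those given by raising at [n] and at [m]. Removal splits
    [j + l] in the same way. *)
Lemma redistribute_Kdisc a f n m :
  redistribute (coproduct (Kdisc s t a) f) n m =
  coproduct (Kdisc s t a) (redistribute f) n m.
Proof.
case: a.
- transitivity ((s + t + n%:R) * redistribute f n.+1 m +
    (s + t + m%:R) * redistribute f n m.+1) => //.
  rewrite /redistribute -(betabin_mean_raise n) -betabin_meanZ -betabin_meanD.
  apply: eq_betabin_mean => k j _.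
  rewrite -(betabin_mean_raise m) -!betabin_meanZ -!betabin_meanD.
  apply: eq_betabin_mean => l i _.
  rewrite /coproduct /= !fctE /first_var /second_var /= !addSn !addnS !natrD; ring.
- transitivity (n%:R * redistribute f n.-1 m + m%:R * redistribute f n m.-1) => //.
  rewrite /redistribute -(betabin_mean_lower n) -betabin_meanZ -betabin_meanD.
  apply: eq_betabin_mean => k j _.
  rewrite -(betabin_mean_lower m) -!betabin_meanZ -!betabin_meanD.
  apply: eq_betabin_mean => l i _.
  rewrite /coproduct /= !fctE /first_var /second_var /= !natrD.
  (* The factor [a] covers [a = 0], where the predecessor of [a + b] would remove a particle from
     [b] instead. *)
  have pred_addl (a b : nat) (F : nat -> R) : a%:R * F (a + b).-1 = a%:R * F (a.-1 + b)%N.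
    by case: a => [|a]; rewrite ?mul0r.
  rewrite !mulrDl (pred_addl j l (f ^~ _)) (pred_addl i k (f _)).
  rewrite (addnC j l) (addnC i k) (pred_addl l j (f ^~ _)) (pred_addl k i (f _)).
  rewrite (addnC j l.-1) (addnC i k.-1); ring.
- transitivity (((s + t) / 2 + n%:R) * redistribute f n m +
    ((s + t) / 2 + m%:R) * redistribute f n m) => //.
  rewrite -mulrDl /redistribute -betabin_meanZ.
  apply: eq_betabin_mean => k j <-; rewrite -betabin_meanZ.
  apply: eq_betabin_mean => l i <-.
  rewrite /coproduct /= !fctE /first_var /second_var /= !natrD; ring.
Qed.

End BetaBinomial.

Section DiscreteSymmetry.
Variables (R : realType) (s t : R).
Hypotheses (s0 : 0 < s) (t0 : 0 < t).
Notation mean := (betabin_mean s t (@Gamma R)).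
Let mean1 := betabin_mean1 s0 t0 (@Gamma_gt0 R) (@GammaD1 R).

(** The rate is the product of the two beta-binomial weights. These are normalised, so the total
    rate is 1 and the loss term is [f] itself, rewritten as a double mean of a constant in order to
    compare termwise. *)
Lemma LdiscE f n m : Ldisc s t f n m = redistribute s t (@Gamma R) f n m - f n m.
Proof.
have -> : f n m =
    mean n (fun k j => mean m (fun l i => f n m * 1)).
  under eq_betabin_mean => k j _ do rewrite betabin_meanZ mean1.
  by rewrite betabin_meanZ mean1 mulr1.
rewrite /Ldisc /redistribute /betabin_mean -sumrB; apply: eq_bigr => k _.
rewrite -mulrBr -sumrB mulr_sumr; apply: eq_bigr => l _.
rewrite mulr1 -mulrBr mulrA; congr (_ * _).
have [kn lm] : (k <= n)%N /\ (l <= m)%N by split; rewrite -ltnS.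
rewrite /rate /betabin /Beta (subnKC kn) (subnKC lm).
move: (@Gamma R) (@Gamma_gt0 R) => G G_gt0.
have [h1 h2 h3] : [/\ G (s + t + n%:R) != 0, G (s + t + m%:R) != 0 &
    G (s + t) != 0].
  have st0 : 0 < s + t by exact: addr_gt0.
  by rewrite !gt_eqF ?G_gt0 // ltr_wpDr.
have [h4 h5] : G s != 0 /\ G t != 0 by rewrite !gt_eqF ?G_gt0.
have [h6 h7 h8 h9] : [/\ k`!%:R != 0 :> R, (n - k)`!%:R != 0 :> R,
  l`!%:R != 0 :> R & (m - l)`!%:R != 0 :> R].
  by rewrite !pnatr_eq0 -!lt0n !fact_gt0.
move: h6 h7 h8 h9; set x := k`!%:R; set y := (n - k)`!%:R.
set z := l`!%:R; set w := (m - l)`!%:R => *.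
by field; do ?[apply/andP; split].
Qed.

Lemma Ldisc_Kdisc a f : commutator (Ldisc s t) (coproduct (Kdisc s t a)) f = 0.
Proof.
apply/funext => n; apply/funext => m.
transitivity (Ldisc s t (coproduct (Kdisc s t a) f) n m -
  coproduct (Kdisc s t a) (Ldisc s t f) n m) => //.
rewrite LdiscE (redistribute_Kdisc s0 t0 (@Gamma_gt0 R) (@GammaD1 R)).
have -> : coproduct (Kdisc s t a) (Ldisc s t f) n m =
    coproduct (Kdisc s t a) (redistribute s t (@Gamma R) f) n m - coproduct (Kdisc s t a) f n m.
  have -> : Ldisc s t f = (fun n m => redistribute s t (@Gamma R) f n m - f n m).
    by apply/funext => i; apply/funext => j; exact: LdiscE.
  by rewrite /coproduct /first_var /second_var; case: a => /=; rewrite !fctE; ring.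
by rewrite subrr.
Qed.

End DiscreteSymmetry.

(** * Differentiation under a bounded functional *)

Section WithinContinuity.
Variable R : realType.

Lemma within_continuousP (T : topologicalType) (A : set T) (f : T -> R) :
  {within A, continuous f} <->
  forall x, A x -> forall e : R, 0 < e -> \forall y \near x, A y -> `|f x - f y| < e.
Proof.
rewrite subspace_continuousP; split => cf x Ax.
  by move=> e e0; move/cvgrPdist_lt/(_ e e0): (cf x Ax).
by apply/cvgrPdist_lt => e e0; exact: cf.
Qed.

Lemma within_continuous_cst (T : topologicalType) (A : set T) (c : R) :
  {within A, continuous (fun=> c)}.
Proof. by apply/within_continuousP => x _ e e0; apply: nearW => y _; rewrite subrr normr0. Qed.

Lemma within_continuousM (T : topologicalType) (A : set T) (f g : T -> R) :
  {within A, continuous f} -> {within A, continuous g} ->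
  {within A, continuous (fun x => f x * g x)}.
Proof. by move=> cf cg x; apply: cvgM; [exact: cf | exact: cg]. Qed.

Lemma within_continuous_add (T : topologicalType) (A : set T) (f g : T -> R) :
  {within A, continuous f} -> {within A, continuous g} ->
  {within A, continuous (fun x => f x + g x)}.
Proof. by move=> cf cg x; apply: cvgD; [exact: cf | exact: cg]. Qed.

Lemma eq_within_continuous (T : topologicalType) (A : set T) (f g : T -> R) :
  (forall x, A x -> f x = g x) ->
  {within A, continuous f} -> {within A, continuous g}.
Proof.
move=> fg /within_continuousP cf; apply/within_continuousP => x Ax e e0.
by apply: filterS (cf x Ax e e0) => y h Ay; rewrite -!fg // h.
Qed.

Lemma within_continuous_subset (T : topologicalType) (A B : set T) (f : T -> R) :
  A `<=` B -> {within B, continuous f} -> {within A, continuous f}.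
Proof. by move=> AB; exact: continuous_subspaceW. Qed.

Lemma within_continuous_precomp (T U : topologicalType) (A : set T) (B : set U)
    (g : T -> U) (f : U -> R) :
  continuous g -> (forall x, A x -> B (g x)) ->
  {within B, continuous f} -> {within A, continuous (fun x => f (g x))}.
Proof.
move=> cg AB /within_continuousP cf; apply/within_continuousP => x Ax e e0.
have := cg x _ (cf _ (AB _ Ax) e e0); rewrite nbhs_simpl /=.
by apply: filterS => y h Ay; exact/h/AB.
Qed.

End WithinContinuity.

Lemma continuous_pair (T U V : topologicalType) (f : T -> U) (g : T -> V) :
  continuous f -> continuous g -> continuous (fun x => (f x, g x)).
Proof. by move=> cf cg x; exact: (cvg_pair (cf x) (cg x)). Qed.

(** * Derivatives relative to a subset of the line *)

Section RelativeDerivative.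
Variable R : realType.
Implicit Types (D : set R) (g : R -> R).

(** For [D] the half-line this is the convergence behind [halfline_derive]. The same notion with [D]
    the unit segment is used for the variables [u] and [v]. *)
Definition derivative_within D g (x l : R) : Prop :=
  halfline_diffquot g x h @[h --> within [set h | D (x + h)] 0^'] --> l.

Lemma derivative_withinP D g x l : derivative_within D g x l <->
  forall e : R, 0 < e -> exists2 d : R, 0 < d &
    forall h, h != 0 -> `|h| < d -> D (x + h) -> `|l - halfline_diffquot g x h| < e.
Proof.
split.
  move=> /cvgrPdist_lt H e /H [d /= d0 Hd]; exists d => // h h0 hd Dh.
  by apply: (Hd h) => //=; rewrite sub0r normrN.
move=> H; apply/cvgrPdist_lt => e /H [d d0 Hd]; exists d => //= h.
by rewrite /ball_ /= sub0r normrN => hd h0 Dh; exact: Hd.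
Qed.

Lemma derivative_within_continuous D g x l : derivative_within D g x l ->
  forall e : R, 0 < e -> \forall y \near x, D y -> `|g x - g y| < e.
Proof.
move=> /derivative_withinP /(_ 1 ltr01)[d d0 Hd] e e0.
(* Tolerance 1 in the definition of the derivative bounds the difference quotients near [x] by
   [|l| + 1]. *)
have M0 : 0 < `|l| + 1 by rewrite ltr_wpDl.
exists (Num.min d (e / (`|l| + 1))) => /=; first by rewrite lt_min d0 divr_gt0.
move=> y; rewrite /ball_ /= lt_min => /andP[yd ye] Dy.
have [->|xy] := eqVneq x y; first by rewrite subrr normr0.
have h0 : y - x != 0 by rewrite subr_eq0 eq_sym.
have := Hd (y - x) h0; rewrite distrC in yd; rewrite (addrC x) subrK => /(_ yd Dy).
rewrite /halfline_diffquot (addrC x) subrK => q1.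
have {}q1 : `|(y - x)^-1 * (g y - g x)| < `|l| + 1.
  rewrite -[X in `|X| < _](subKr l); apply: le_lt_trans (ler_normB _ _) _.
  by rewrite ltrD2l.
move: q1; rewrite normrM normfV ltr_pdivrMl ?normr_gt0 // => q1.
rewrite distrC; apply: (lt_le_trans q1).
by rewrite -ler_pdivlMr // distrC ltW.
Qed.

Lemma derivative_within_is_derive D g x l :
  (\forall y \near x, D y) -> derivative_within D g x l -> is_derive x 1 g l.
Proof.
move=> [r /= r0 Hr] /derivative_withinP H.
suff cv : h^-1 *: ((g \o shift x) (h *: 1) - g x) @[h --> 0^'] --> l.
  by split; [apply/cvg_ex; exists l | exact/cvg_lim].
apply/cvgrPdist_lt => e /H[d d0 Hd]; exists (Num.min r d) => /=.
  by rewrite lt_min r0.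
move=> h /=; rewrite sub0r normrN lt_min => /andP[hr hd] h0.
have -> : h *: (1 : R) = h by rewrite /GRing.scale /= mulr1.
rewrite (addrC h); apply: Hd => //; apply: Hr => /=.
by rewrite opprD addNKr normrN.
Qed.

(** Interior points of the segment between [a] and [b] have an ordinary derivative, and continuity
    at its ends follows from the relative one. The order of [a] and [b] is free because increments
    may have either sign; the bound on [c - a] later keeps [c] in a neighbourhood of [a]. *)
Lemma MVT_within D g (g' : R -> R) (a b : R) : is_interval D -> D a -> D b ->
  (forall x, D x -> derivative_within D g x (g' x)) ->
  exists c, [/\ D c, `|c - a| <= `|b - a| & g b - g a = g' c * (b - a)].
Proof.
move=> iD Da Db Hg.
have main (p q : R) : p < q -> D p -> D q ->
    exists c, [/\ D c, p <= c, c <= q & g q - g p = g' c * (q - p)].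
  move=> pq Dp Dq.
  have sub x : p <= x -> x <= q -> D x by move=> ? ?; apply: (iD _ _ Dp Dq); apply/andP.
  have [||c] := @MVT R g g' p q pq.
  - move=> x; rewrite in_itv/= => /andP[px xq].
    apply: (@derivative_within_is_derive D); last by apply: Hg; apply: sub; exact: ltW.
    have : \forall y \near x, y \in `]p, q[ by apply: near_in_itvoo; rewrite in_itv/= px.
    by apply: filterS => y; rewrite in_itv/= => /andP[py yq]; apply: sub; exact: ltW.
  - apply/within_continuousP => x /=; rewrite in_itv/= => /andP[px xq] e e0.
    have := derivative_within_continuous (Hg _ (sub _ px xq)) e0.
    apply: filterS => y h /=; rewrite in_itv/= => /andP[py yq].
    exact/h/sub.
  rewrite in_itv/= => /andP[pc cq] E; exists c; split => //; rewrite ?ltW //.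
  by apply: sub; exact: ltW.
have [ab|ba|<-] := ltgtP a b.
- have [c [Dc ac cb E]] := main _ _ ab Da Db; exists c; split => //.
  by rewrite !ger0_norm ?subr_ge0 // ?lerD2r // ltW.
- have [c [Dc bc ca E]] := main _ _ ba Db Da; exists c; split => //.
    by rewrite !ler0_norm ?subr_le0 ?(ltW ba) // !opprB lerD2l lerN2.
  by rewrite -[LHS]opprB E -mulrN opprB.
- by exists a; split => //; rewrite !subrr mulr0.
Qed.

End RelativeDerivative.

(** * Linear functionals bounded by the supremum norm *)

Section BoundedFunctional.
Variables (R : realType) (T : topologicalType) (K : set T).

(** Abstracts integration against an integrable weight. Both clauses are restricted to functions
    continuous on [K], where the integrals converge, and [e] stands for any bound of [f] on [K]. *)
Definition bounded_functional (Lam : (T -> R) -> R) : Prop :=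
  (forall (c : R) (f g : T -> R), {within K, continuous f} -> {within K, continuous g} ->
    Lam (fun u => c * f u + g u) = c * Lam f + Lam g) /\
  exists C : R, forall (f : T -> R) (e : R), {within K, continuous f} -> 0 <= e ->
    (forall u, K u -> `|f u| <= e) -> `|Lam f| <= C * e.

Hypothesis cK : compact K.
Variable Lam : (T -> R) -> R.
Implicit Types f g : T -> R.
Hypothesis bLam : bounded_functional Lam.

Lemma functionalD f g : {within K, continuous f} -> {within K, continuous g} ->
  Lam (fun u => f u + g u) = Lam f + Lam g.
Proof.
move=> cf cg; have [lin _] := bLam.
rewrite -[RHS]/(Lam f + Lam g) -[Lam f]mul1r -lin //; congr Lam.
by apply/funext => u; rewrite mul1r.
Qed.

Lemma functional0 : Lam (fun=> 0) = 0.
Proof.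
have := functionalD (@within_continuous_cst R T K 0) (@within_continuous_cst R T K 0).
rewrite (_ : (fun=> 0 + 0) = (fun=> 0)) => [/eqP|]; last by apply/funext => u; rewrite addr0.
by rewrite -[X in X == _]addr0 => /eqP/addrI.
Qed.

Lemma functionalZ c f : {within K, continuous f} ->
  Lam (fun u => c * f u) = c * Lam f.
Proof.
move=> cf; have [lin _] := bLam.
have := lin c f (fun=> 0) cf (@within_continuous_cst R T K 0).
rewrite functional0 addr0 => <-; congr Lam.
by apply/funext => u; rewrite addr0.
Qed.

Lemma functionalB f g : {within K, continuous f} -> {within K, continuous g} ->
  Lam (fun u => f u - g u) = Lam f - Lam g.
Proof.
move=> cf cg; rewrite addrC -mulN1r; have [lin _] := bLam; rewrite -lin //; congr Lam.
by apply/funext => u; rewrite mulN1r addrC.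
Qed.

(** The difference is bounded by [e = 0] on [K], so the boundedness clause makes its value 0. *)
Lemma eq_functional f g : {within K, continuous f} -> (forall u, K u -> f u = g u) ->
  Lam f = Lam g.
Proof.
move=> cf fg; have cg := eq_within_continuous fg cf.
apply/eqP; rewrite -subr_eq0 -functionalB // -normr_le0.
have [_ [C HC]] := bLam; rewrite -(mulr0 C); apply: HC => //.
  apply: eq_within_continuous (@within_continuous_cst R T K 0) => u Ku.
  by rewrite fg // subrr.
by move=> u Ku; rewrite fg // subrr normr0.
Qed.

(** The last hypothesis is convergence uniform near each point of [K]. Compactness, in its
    near-covering form, makes it uniform on [K], and boundedness turns this into convergence of the
    values. *)
Lemma functional_cvg (I : Type) (F : set_system I) (q : I -> T -> R) (q0 : T -> R) :
  Filter F -> (\forall i \near F, {within K, continuous (q i)}) ->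
  {within K, continuous q0} ->
  (forall u, K u -> forall e : R, 0 < e ->
    \forall u' \near u & i \near F, K u' -> `|q0 u - q i u'| < e) ->
  Lam (q i) @[i --> F] --> Lam q0.
Proof.
move=> FF cq cq0 H; apply/cvgrPdist_lt => e e0.
have [_ [C HC]] := bLam.
(* [C] may be zero or negative; [|C| + 1] is a positive divisor and makes the final inequality
   strict. *)
pose e1 := e / (`|C| + 1); have C0 : 0 < `|C| + 1 by rewrite ltr_wpDl.
have e10 : 0 < e1 by rewrite divr_gt0.
have /compact_near_coveringP/near_covering_withinP cov := cK.
have nearF := cov I F (fun i u => `|q0 u - q i u| < e1) FF.
have {}nearF : \forall i \near F, K `<=` (fun u => `|q0 u - q i u| < e1).
  apply: nearF => u Ku; have e20 : 0 < e1 / 2 by rewrite divr_gt0.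
  have [[U V] [/= Uu FV] UV] := H u Ku _ e20.
  have /within_continuousP/(_ u Ku _ e20) Wu := cq0.
  exists (U `&` [set u' | K u' -> `|q0 u - q0 u'| < e1 / 2], V) => /=.
    by split => //; exact: filterI.
  move=> [u' i] /= [[Uu' h1] Vi] Ku'.
  have h2 := UV (u', i) (conj Uu' Vi) Ku'.
  rewrite [e1]splitr; apply: le_lt_trans (ler_distD (q0 u) _ _) _.
  by rewrite ltrD // distrC; exact: h1.
near=> i; have ci : {within K, continuous (q i)} by near: i.
have le1 : forall u, K u -> `|q0 u - q i u| <= e1.
  by move=> u Ku; apply: ltW; move: u Ku; near: i.
rewrite -functionalB //.
have cB : {within K, continuous (fun u => q0 u - q i u)}.
  by move=> u; apply: cvgB; [exact: cq0 | exact: ci].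
apply: (le_lt_trans (HC _ _ cB (ltW e10) le1)).
apply: (@le_lt_trans _ _ (`|C| * e1)); first by rewrite ler_wpM2r ?ler_norm // ltW.
rewrite /e1 mulrCA gtr_pMr // ltr_pdivrMr // mul1r; lra.
Unshelve. all: by end_near. Qed.

Lemma functional_continuous (X : topologicalType) (A : set X) (G : X -> T -> R) :
  {within A `*` K, continuous (fun z => G z.1 z.2)} ->
  {within A, continuous (fun x => Lam (G x))}.
Proof.
move=> cG; apply/subspace_continuousP => x Ax.
have cx y : A y -> {within K, continuous (G y)}.
  move=> Ay; apply: (within_continuous_precomp (g := fun u => (y, u)) _ _ cG) => //.
  by apply: continuous_pair => v; [exact: cvg_cst | exact: cvg_id].
apply: functional_cvg => //.
- by apply: filterS (withinT _ _) => //; exact: cx.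
- exact: cx.
move=> u Ku e e0.
have /within_continuousP/(_ (x, u) (conj Ax Ku) e e0) := cG.
move=> [[U V] [/= Ux Vu] UV].
exists (V, [set y | A y /\ U y]) => /=.
  by split => //; rewrite /within /=; apply: filterS Ux.
move=> [u' y] /= [Vu' [Ay Uy]] Ku'.
exact: (UV (y, u') (conj Uy Vu') (conj Ay Ku')).
Qed.

(** By the mean value theorem the difference quotient at [u] is [G' c u] with [c] between [x] and
    [x + h]. The point [c] depends on [u], but joint continuity of [G'] still gives the convergence
    that [functional_cvg] asks for. *)
Lemma functional_derivative (D : set R) (G G' : R -> T -> R) (x : R) :
  is_interval D -> D x ->
  (forall y, D y -> {within K, continuous (G y)}) ->
  (forall u, K u -> forall y, D y -> derivative_within D (G ^~ u) y (G' y u)) ->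
  {within D `*` K, continuous (fun z => G' z.1 z.2)} ->
  derivative_within D (fun y => Lam (G y)) x (Lam (G' x)).
Proof.
move=> iD Dx cG dG cG'.
have cq h : D (x + h) -> {within K, continuous (fun u => h^-1 * (G (x + h) u - G x u))}.
  move=> Dh; apply: within_continuousM; first exact: within_continuous_cst.
  by move=> u; apply: cvgB; exact: cG.
suff : Lam (fun u => h^-1 * (G (x + h) u - G x u))
    @[h --> within [set h | D (x + h)] 0^'] --> Lam (G' x).
  apply: cvg_trans; apply: near_eq_cvg; apply: filterS (withinT _ _) => h Dh.
  rewrite functionalZ ?functionalB //; try exact: cG.
  by move=> u; apply: cvgB; exact: cG.
apply: functional_cvg.
- by apply: filterS (withinT _ _) => h; exact: cq.
- apply: (within_continuous_precomp (g := fun u => (x, u)) _ _ cG') => //.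
  by apply: continuous_pair => v; [exact: cvg_cst | exact: cvg_id].
move=> u Ku e e0.
have /within_continuousP/(_ (x, u) (conj Dx Ku) e e0) := cG'.
move=> [[U V] [/= [r /= r0 Ux] Vu] UV].
exists (V, [set h | [/\ h != 0, D (x + h) & `|h| < r]]) => /=.
  split => //; exists r => //= h; rewrite /ball_ /= sub0r normrN => hr h0 Dh.
  by split.
move=> [u' h] /= [Vu' [h0 Dh hr]] Ku'.
have [c [Dc ch E]] := MVT_within iD Dx Dh (dG u' Ku').
rewrite E (addrC x) addrK mulrC mulfK //.
apply: (UV (c, u')) => //=; split => //; apply: Ux => /=.
by rewrite /ball_ /= distrC (le_lt_trans ch) // (addrC x) addrK.
Qed.

End BoundedFunctional.

(** * Chain rule along affine paths in the quadrant *)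

Section ChainRule.
Variables (R : realType) (f fx fy : R -> R -> R).
Notation halfline := [set z : R | 0 <= z].
Hypothesis Dx : forall x y, 0 <= x -> 0 <= y -> derivative_within halfline (f ^~ y) x (fx x y).
Hypothesis Dy : forall x y, 0 <= x -> 0 <= y -> derivative_within halfline (f x) y (fy x y).
Hypothesis cfx : {within @quadrant R, continuous (fun z : R * R => fx z.1 z.2)}.
Hypothesis cfy : {within @quadrant R, continuous (fun z : R * R => fy z.1 z.2)}.

Lemma is_interval_halfline : is_interval halfline.
Proof. by move=> x y /= x0 _ z /andP[xz _]; exact: le_trans xz. Qed.

Lemma quadrant_continuousP (g : R -> R -> R) (x y e : R) :
  {within @quadrant R, continuous (fun z : R * R => g z.1 z.2)} ->
  0 <= x -> 0 <= y -> 0 < e ->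
  exists2 d, 0 < d & forall x' y', 0 <= x' -> 0 <= y' -> `|x' - x| < d -> `|y' - y| < d ->
    `|g x y - g x' y'| < e.
Proof.
move=> /within_continuousP cg x0 y0 e0.
have [[U V] [/= [r r0 Ux] [r' r'0 Vy]] UV] := cg (x, y) (conj x0 y0) e e0.
exists (Num.min r r') => [|x' y' x'0 y'0]; first by rewrite lt_min r0.
rewrite !lt_min => /andP[x1 _] /andP[_ y1].
apply: (UV (x', y')) => //=; split.
  by apply: Ux; rewrite /= distrC.
by apply: Vy; rewrite /= distrC.
Qed.

(** The increment is split at the corner [(a x, b (x + h))], which lies in the quadrant, a product
    set; the mean value theorem applies to each piece. Affine paths suffice: the exchange is affine
    in each of [x], [y], [u], [v] separately. *)
Lemma chain_rule_affine (D : set R) (a b : R -> R) (al be x : R) :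
  D x -> (forall y, D y -> 0 <= a y) -> (forall y, D y -> 0 <= b y) ->
  (forall y h, a (y + h) = a y + h * al) -> (forall y h, b (y + h) = b y + h * be) ->
  derivative_within D (fun y => f (a y) (b y)) x
    (al * fx (a x) (b x) + be * fy (a x) (b x)).
Proof.
move=> Dx0 a0 b0 aE bE; apply/derivative_withinP => e e0.
(* [M] serves twice: it exceeds both slopes, so that increments of [a] and [b] are at most [|h| M],
   and it exceeds their sum, so that two errors [e / M] add up to less than [e]. *)
pose M := 1 + `|al| + `|be|.
have M0 : 0 < M by rewrite /M -addrA ltr_pwDl // addr_ge0.
have eM : 0 < e / M by rewrite divr_gt0.
have [d1 d10 H1] := quadrant_continuousP cfx (a0 _ Dx0) (b0 _ Dx0) eM.
have [d2 d20 H2] := quadrant_continuousP cfy (a0 _ Dx0) (b0 _ Dx0) eM.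
exists (Num.min d1 d2 / M) => [|h h0 hd Dh].
  by rewrite divr_gt0 // lt_min d10.
have {}hd c : `|c| < M -> `|h * c| < d1 /\ `|h * c| < d2.
  move=> cM; have : `|h * c| < Num.min d1 d2.
    rewrite normrM; apply: le_lt_trans (_ : _ <= `|h| * M) _.
      by rewrite ler_wpM2l // ltW.
    by rewrite -ltr_pdivlMr.
  by rewrite lt_min => /andP[].
have alM : `|al| < M by rewrite /M addrAC ltr_pwDl // ?ltr_pwDl // lerDr.
have beM : `|be| < M by rewrite /M ltr_pwDl // ltr_pwDl.
have [ax bx ah bh] : [/\ 0 <= a x, 0 <= b x, 0 <= a (x + h) & 0 <= b (x + h)].
  by split; do [exact: a0|exact: b0].
have [c [c0 ca E1]] := MVT_within is_interval_halfline ax ah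
  (fun y y0 => Dx y0 bh).
have [c' [c'0 cb E2]] := MVT_within is_interval_halfline bx bh
  (fun y y0 => Dy ax y0).
rewrite aE (addrC (a x)) addrK in ca E1; rewrite bE (addrC (b x)) addrK in cb E2.
have -> : halfline_diffquot (fun y => f (a y) (b y)) x h =
    al * fx c (b (x + h)) + be * fy (a x) c'.
  rewrite /halfline_diffquot.
  have -> : f (a (x + h)) (b (x + h)) - f (a x) (b x) =
      fx c (b (x + h)) * (h * al) + fy (a x) c' * (h * be).
    by rewrite -E1 -E2 /= aE bE !(addrC (h * _)); ring.
  by field.
have F1 : `|fx (a x) (b x) - fx c (b (x + h))| < e / M.
  apply: H1 => //; first by apply: le_lt_trans ca _; case: (hd _ alM).
  by rewrite bE (addrC (b x)) addrK; case: (hd _ beM).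
have F2 : `|fy (a x) (b x) - fy (a x) c'| < e / M.
  apply: H2 => //; first by rewrite subrr normr0.
  by apply: le_lt_trans cb _; case: (hd _ beM).
rewrite opprD addrACA -!mulrBr; apply: le_lt_trans (ler_normD _ _) _.
rewrite !normrM; apply: (@le_lt_trans _ _ (`|al| * (e / M) + `|be| * (e / M))).
  by rewrite lerD // ler_wpM2l // ltW.
by rewrite -mulrDl mulrCA gtr_pMr // ltr_pdivrMr // mul1r /M -addrA ltrDr.
Qed.

End ChainRule.

(** * The Beta functional and integration by parts *)

Lemma within_continuous_bounded (R : realType) (T : topologicalType) (K : set T)
    (f : T -> R) : compact K -> {within K, continuous f} ->
  exists2 M, 0 <= M & forall u, K u -> `|f u| <= M.
Proof.
move=> cK cf; have /compact_bounded[M [_ HM]] := continuous_compact cf cK.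
exists (Num.max 0 (M + 1)); first by rewrite le_max lexx.
move=> u Ku; rewrite le_max; apply/orP; right.
by apply: (HM (M + 1)); [rewrite ltrDl | exists u].
Qed.

(** The point is that the inner functional yields a function continuous in [v], by
    [functional_continuous], so that the clauses for [J'] apply to it. *)
Lemma bounded_functional_prod (R : realType) (T U : topologicalType)
    (K : set T) (K' : set U) (J : (T -> R) -> R) (J' : (U -> R) -> R) :
  compact K -> bounded_functional K J -> bounded_functional K' J' ->
  bounded_functional (K `*` K') (fun f => J' (fun v => J (fun u => f (u, v)))).
Proof.
move=> cK bJ bJ'.
have slice (f : T * U -> R) v : K' v -> {within K `*` K', continuous f} ->
    {within K, continuous (fun u => f (u, v))}.
  move=> Kv; apply: (within_continuous_precomp (g := fun u => (u, v))) => //.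
  by apply: continuous_pair => u; [exact: cvg_id | exact: cvg_cst].
have outer (f : T * U -> R) : {within K `*` K', continuous f} ->
    {within K', continuous (fun v => J (fun u => f (u, v)))}.
  move=> cf; apply: (functional_continuous cK bJ).
  apply: (within_continuous_precomp (g := fun z : U * T => (z.2, z.1)) _ _ cf) => [|z [? ?]//].
  by apply: continuous_pair => z; [exact: cvg_snd | exact: cvg_fst].
split.
- move=> c f g cf cg; rewrite -(proj1 bJ') //; try exact: outer.
  apply: (eq_functional bJ').
    apply: (outer (fun z => c * f z + g z)); apply: within_continuous_add => //.
    by apply: within_continuousM => //; exact: within_continuous_cst.
  by move=> v Kv; rewrite (proj1 bJ) //; exact: slice.
- have [_ [C HC]] := bJ; have [_ [C' HC']] := bJ'.
  exists (`|C'| * `|C|) => f e cf e0 fe; rewrite -mulrA.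
  have inner v : K' v -> `|J (fun u => f (u, v))| <= `|C| * e.
    move=> Kv; apply: (@le_trans _ _ (C * e)).
      by apply: HC => //; [exact: slice | move=> u Ku; exact: fe].
    by rewrite ler_wpM2r // ler_norm.
  have Ce0 : 0 <= `|C| * e by rewrite mulr_ge0.
  apply: (le_trans (HC' _ _ (outer f cf) Ce0 inner)).
  by rewrite ler_wpM2r // ler_norm.
Qed.

Section BetaFunctional.
Variables (R : realType) (s t : R).
Hypotheses (s0 : 0 < s) (t0 : 0 < t).
Notation mu := (@lebesgue_measure R).
Notation w := (beta_density s t).
Notation seg := (`[0, 1]%classic : set R).
Implicit Types f g : R -> R.

(** Not normalised: the constant in [phi] is restored in [LcontE]. Test functions are continuous on
    the closed segment, whose compactness bounds them. *)
Definition beta_integral f : R := \int[mu]_(u in `]0, 1[) (f u * w u).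

Lemma beta_integrand_integrable f : {within seg, continuous f} ->
  mu.-integrable `]0, 1[ (EFin \o (fun u => f u * w u)).
Proof.
move=> cf; have sub : `]0, 1[ `<=` seg by exact: subset_itv_oo_cc.
have [M M0 HM] := within_continuous_bounded (@segment_compact R 0 1) cf.
have iw := beta_density_integrable s0 t0.
have mw : measurable_fun (`]0, 1[ : set R) w.
  by apply/measurable_EFinP; exact: (measurable_int _ iw).
have mf : measurable_fun (`]0, 1[ : set R) f.
  apply: subspace_continuous_measurable_fun => //.
  exact: within_continuous_subset cf.
apply: (le_integrable _ _ _ (integrableZl _ M iw)) => //.
  by apply/measurable_EFinP; exact: measurable_funM.
move=> x x01; rewrite lee_fin !normrM.
apply: ler_pM => //; apply: le_trans (ler_norm _); apply: HM; exact: sub.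
Qed.

Lemma beta_integral_bounded : bounded_functional seg beta_integral.
Proof.
have iw := beta_density_integrable s0 t0.
split.
- move=> c f g cf cg; have i1 := beta_integrand_integrable cf.
  have i2 := beta_integrand_integrable cg.
  have i3 : mu.-integrable `]0, 1[ (EFin \o (fun u => c * (f u * w u))).
    exact: (integrableZl _ c i1).
  rewrite /beta_integral -(RintegralZl _ _ i1) // -(RintegralD _ i3 i2) //.
  by apply: eq_Rintegral => u _; rewrite mulrDl mulrA.
- exists (\int[mu]_(u in `]0, 1[) w u) => f e cf e0 fe.
  have i1 := beta_integrand_integrable cf.
  apply: le_trans (le_normr_Rintegral _ i1) _ => //.
  rewrite -(RintegralZr _ _ iw) //; apply: le_Rintegral => //.
  + exact: (integrable_norm i1).
  + exact: (integrableZr _ e iw).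
  + move=> u u01; rewrite normrM (ger0_norm (beta_density_ge0 _ _ _)) mulrC.
    by rewrite ler_wpM2l ?beta_density_ge0 // fe //; exact: (subset_itv_oo_cc u01).
Qed.

(** The integrand times the density is the derivative of [u^s (1 - u)^t g(u)], as
    [s (1 - u) - t u = s - (s + t) u]. The boundary terms vanish because [s] and [t] are positive
    and [g] is bounded. *)
Lemma beta_integral_by_parts g g' :
  (forall u, seg u -> derivative_within seg g u (g' u)) ->
  {within seg, continuous g'} ->
  beta_integral (fun u => (s - (s + t) * u) * g u + u * (1 - u) * g' u) = 0.
Proof.
move=> dg cg'.
pose H u := u `^ s * (1 - u) `^ t * g u.
pose q u := (s - (s + t) * u) * g u + u * (1 - u) * g' u.
pose h u := q u * w u.
have cg : {within seg, continuous g}.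
  by apply/within_continuousP => x x01; exact: derivative_within_continuous (dg x x01).
have nb (x : R) : `]0, 1[%classic x -> \forall y \near x, seg y.
  move=> x01; have : \forall y \near x, y \in `]0, 1[ by exact: near_in_itvoo.
  by apply: filterS => y; exact: subset_itv_oo_cc.
have dgx (x : R) : `]0, 1[%classic x -> is_derive x 1 g (g' x).
  move=> x01; apply: derivative_within_is_derive (nb _ x01) (dg _ _).
  exact: subset_itv_oo_cc.
have dH (x : R) : `]0, 1[%classic x -> is_derive x 1 H (h x).
  move=> x01; have := x01; rewrite /= in_itv/= => /andP[x0 x1].
  apply: is_derive_eq.
    exact: (is_derive1M (is_derive1M (is_derive1_powR s x0)
      (is_derive1_onem_powR t x1)) (dgx x x01)).
  rewrite /h /q /beta_density (powR_sub1 s x0) (@powR_sub1 _ t (1 - x)); last lra.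
  ring.
have cid : continuous (fun u : R => u) by move=> u; exact: cvg_id.
have cq : {within seg, continuous q}.
  have cs (f : R -> R) : continuous f -> {within seg, continuous f}.
    by move=> cf; exact: continuous_subspaceT.
  apply: within_continuous_add; apply: within_continuousM => //; apply: cs => u.
    by apply: cvgB; [exact: cvg_cst | apply: cvgM; [exact: cvg_cst | exact: cvg_id]].
  by apply: cvgM; [exact: cvg_id | apply: cvgB; [exact: cvg_cst | exact: cvg_id]].
have ch (x : R) : `]0, 1[%classic x -> {for x, continuous h}.
  move=> x01; have := x01; rewrite /= in_itv/= => /andP[x0 x1].
  apply: cvgM; last exact: beta_density_continuous.
  have /subspace_continuousP/(_ x) := cq; rewrite within_interior.
    by apply; exact: (subset_itv_oo_cc x01).
  exact: nb.
have ih : mu.-integrable `]0, 1[ (EFin \o h) by exact: beta_integrand_integrable.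
have [M M0 HM] := within_continuous_bounded (@segment_compact R 0 1) cg.
pose a (n : nat) : R := n.+3%:R^-1.
have a01 n : 0 < a n < 1.
  by rewrite invr_gt0 ltr0n /= invf_lt1 ?ltr1n.
have ca p : 0 < p -> M * a n `^ p @[n --> \oo] --> 0.
  move=> p0; rewrite -(mulr0 M); apply: cvgM; first exact: cvg_cst.
  apply: (cvg_comp _ _ _ (powR_cvg0 p0)) => A.
  have cn : a n @[n --> \oo] --> 0.
    rewrite (cvg_shiftS (fun n => n.+2%:R^-1 : R)).
    by rewrite (cvg_shiftS (fun n => n.+1%:R^-1 : R)); exact: cvg_harmonic.
  move=> /cn [N _ HN]; exists N => // n Nn; apply: HN => //=.
  by case/andP: (a01 n).
(* The first bound gives the limit at 0, the second the limit at 1. *)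
have bd x : 0 < x -> x < 1 -> `|H x| <= M * x `^ s /\ `|H x| <= M * (1 - x) `^ t.
  move=> x0 x1; have gM : `|g x| <= M.
    by apply: HM; rewrite /= in_itv/= !ltW.
  rewrite /H !normrM !(ger0_norm (powR_ge0 _ _)) mulrC; split; apply: ler_pM => //.
  - by rewrite mulr_ge0 ?powR_ge0.
  - by rewrite ler_piMr ?powR_ge0 //; apply: powR_le1; [exact: ltW | lra | lra].
  - by rewrite mulr_ge0 ?powR_ge0.
  - by rewrite ler_piMl ?powR_ge0 // powR_le1 ?ltW.
have sq (x : nat -> R) p : 0 < p -> (forall n, `|H (x n)| <= M * a n `^ p) ->
    H (x n) @[n --> \oo] --> 0.
  move=> p0 Hx; have c := ca p p0.
  apply: (@squeeze_cvgr _ _ _ _ (fun n => - (M * a n `^ p)) (fun n => M * a n `^ p)) => //.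
    by apply: nearW => n; rewrite -ler_norml.
  by rewrite -oppr0; exact: cvgN.
have H0 : H (a n) @[n --> \oo] --> 0.
  by apply: (sq _ s) => // n; case/andP: (a01 n) => n0 n1; case: (bd _ n0 n1).
have H1 : H (1 - a n) @[n --> \oo] --> 0.
  apply: (sq _ t) => // n; case/andP: (a01 n) => n0 n1.
  have [||_] := bd (1 - a n); [by rewrite subr_gt0 | by rewrite gtrBl | by rewrite subKr].
rewrite -[RHS](subrr 0).
exact: (Rintegral_FTC2_exhausts (exhausts_oo01 R) dH ch ih H0 H1).
Qed.

End BetaFunctional.

(** * Smooth functions on the quadrant *)

Section HalflineDerivative.
Variable R : realType.
Notation halfline := [set z : R | 0 <= z].
Implicit Types (f g : R -> R) (D : set R).

Lemma derivative_withinD D f g x l m : derivative_within D f x l ->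
  derivative_within D g x m -> derivative_within D (fun y => f y + g y) x (l + m).
Proof.
move=> Df Dg; rewrite /derivative_within.
rewrite (_ : halfline_diffquot _ x = halfline_diffquot f x \+ halfline_diffquot g x).
  exact: cvgD Df Dg.
by apply/funext => h; rewrite /halfline_diffquot /=; ring.
Qed.

Lemma derivative_withinZ D f x l c : derivative_within D f x l ->
  derivative_within D (fun y => c * f y) x (c * l).
Proof.
move=> Df; rewrite /derivative_within.
rewrite (_ : halfline_diffquot _ x = (fun h => c * halfline_diffquot f x h)).
  by apply: cvgM => //; exact: cvg_cst.
by apply/funext => h; rewrite /halfline_diffquot /=; ring.
Qed.

Lemma derivative_withinM_id D f x l : derivative_within D f x l ->
  derivative_within D (fun y => y * f y) x (f x + x * l).
Proof.
move=> Df; rewrite /derivative_within.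
have ch : h @[h --> within [set h | D (x + h)] 0^'] --> (0 : R).
  by apply: cvg_within_filter; apply: cvg_within_filter; exact: cvg_id.
(* With [q] the difference quotient of [f], that of [y * f y] is [f x + x q + h q]; the summand
   [0 * l] is the limit of [h q]. *)
have -> : f x + x * l = f x + (x * l + 0 * l) by rewrite mul0r addr0.
suff : f x + (x * halfline_diffquot f x h + h * halfline_diffquot f x h)
    @[h --> within [set h | D (x + h)] 0^'] --> f x + (x * l + 0 * l).
  apply: cvg_trans; apply: near_eq_cvg.
  have n0 : \forall h \near 0^', h != 0 :> R by exact: nbhs_dnbhs_neq.
  apply: filterS n0 => h h0 _ /=; rewrite /halfline_diffquot; by field.
apply: cvgD; first exact: cvg_cst.
by apply: cvgD; apply: cvgM => //; exact: cvg_cst.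
Qed.

Lemma halfline_nbhs_proper (x : R) : 0 <= x -> ProperFilter (halfline_nbhs x).
Proof.
move=> x0; apply: Build_ProperFilter_ex => P [d /= d0 Hd].
exists (d / 2); apply: Hd => /=; last by rewrite addr_ge0 ?divr_ge0 // ltW.
- rewrite /ball_ /= sub0r normrN gtr0_norm ?divr_gt0 //; lra.
- by rewrite gt_eqF ?divr_gt0.
Qed.

Lemma halfline_deriveE f (x l : R) : 0 <= x -> derivative_within halfline f x l ->
  halfline_derivable f x /\ halfline_derive f x = l.
Proof.
move=> x0 Df; have pf := halfline_nbhs_proper x0.
by split; [apply/cvg_ex; exists l | exact/cvg_lim].
Qed.

(** An equality of image filters transfers both the existence of the limit and its value. *)
Lemma eq_halfline_diffquot f g (x : R) : 0 <= x -> (forall z, 0 <= z -> f z = g z) ->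
  (halfline_diffquot f x h @[h --> halfline_nbhs x]) =
  (halfline_diffquot g x h @[h --> halfline_nbhs x]).
Proof.
have sub (f1 f2 : R -> R) : 0 <= x -> (forall z, 0 <= z -> f1 z = f2 z) ->
    (halfline_diffquot f1 x h @[h --> halfline_nbhs x]) `<=`
    (halfline_diffquot f2 x h @[h --> halfline_nbhs x]).
  move=> x0 E P HP.
  apply: (filterS _ (HP : 0^' (fun h => 0 <= x + h -> P (halfline_diffquot f1 x h)))).
  by move=> h Ph xh /=; rewrite /halfline_diffquot -!E //; exact: Ph.
by move=> x0 fg; apply/seteqP; split; apply: sub => // z z0; rewrite fg.
Qed.

Lemma eq_halfline_derive f g (x : R) : 0 <= x -> (forall z, 0 <= z -> f z = g z) ->
  halfline_derive f x = halfline_derive g x.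
Proof. by move=> x0 fg; rewrite /halfline_derive (eq_halfline_diffquot x0 fg). Qed.

End HalflineDerivative.

Section QuadrantCk.
Variable R : realType.
Notation halfline := [set z : R | 0 <= z].
Notation D1 := (first_var (@halfline_derive R)).
Notation D2 := (second_var (@halfline_derive R)).
Notation quadrant_continuous f :=
  {within @quadrant R, continuous (fun z : R * R => f z.1 z.2)}.
Implicit Types f g : R -> R -> R.

Definition eq_on_quadrant f g : Prop := forall x y, 0 <= x -> 0 <= y -> f x y = g x y.

Lemma eq_first_derive f g : eq_on_quadrant f g -> eq_on_quadrant (D1 f) (D1 g).
Proof. by move=> fg x y x0 y0; apply: eq_halfline_derive => // z z0; exact: fg. Qed.

Lemma eq_second_derive f g : eq_on_quadrant f g -> eq_on_quadrant (D2 f) (D2 g).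
Proof. by move=> fg x y x0 y0; apply: eq_halfline_derive => // z z0; exact: fg. Qed.

Lemma quadrant_Ck_continuous k f : quadrant_Ck k f -> quadrant_continuous f.
Proof. by case: k => [|k] []. Qed.

Lemma quadrant_Ck_first k f : quadrant_Ck k.+1 f -> forall x y, 0 <= x -> 0 <= y ->
  derivative_within halfline (f ^~ y) x (D1 f x y).
Proof. by move=> [_ [H _ _]] x y x0 y0; case: (H x y x0 y0). Qed.

Lemma quadrant_Ck_second k f : quadrant_Ck k.+1 f -> forall x y, 0 <= x -> 0 <= y ->
  derivative_within halfline (f x) y (D2 f x y).
Proof. by move=> [_ [H _ _]] x y x0 y0; case: (H x y x0 y0). Qed.

Lemma eq_quadrant_Ck k f g : eq_on_quadrant f g -> quadrant_Ck k f -> quadrant_Ck k g.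
Proof.
elim: k f g => [|k IH] f g fg [cf Hf].
  by split=> //; apply: eq_within_continuous cf => z [? ?]; exact: fg.
split; first by apply: eq_within_continuous cf => z [? ?]; exact: fg.
case: Hf => df f1 f2; split.
- move=> x y x0 y0; have [dx dy] := df x y x0 y0.
  rewrite /halfline_derivable; split.
    by rewrite -(eq_halfline_diffquot (f := f ^~ y) x0) // => z z0; exact: fg.
  by rewrite -(eq_halfline_diffquot (f := f x) y0) // => z z0; exact: fg.
- exact: IH (eq_first_derive fg) f1.
- exact: IH (eq_second_derive fg) f2.
Qed.

Lemma quadrant_CkS k f : quadrant_Ck k.+1 f -> quadrant_Ck k f.
Proof.
elim: k f => [|k IH] f [cf [df f1 f2]]; first by split.
by split => //; split => //; exact: IH.
Qed.

(** Lets the partial derivatives be given by formulas valid on the quadrant; they are then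
    transported to the limits that [quadrant_Ck] mentions. *)
Lemma quadrant_Ck_intro k f fx fy : quadrant_continuous f ->
  (forall x y, 0 <= x -> 0 <= y -> derivative_within halfline (f ^~ y) x (fx x y)) ->
  (forall x y, 0 <= x -> 0 <= y -> derivative_within halfline (f x) y (fy x y)) ->
  quadrant_Ck k fx -> quadrant_Ck k fy -> quadrant_Ck k.+1 f.
Proof.
move=> cf Dx Dy Cx Cy; split => //; split.
- move=> x y x0 y0.
  by split; [case: (halfline_deriveE x0 (Dx _ _ x0 y0))|case: (halfline_deriveE y0 (Dy _ _ x0 y0))].
- apply: eq_quadrant_Ck Cx => x y x0 y0.
  by case: (halfline_deriveE x0 (Dx _ _ x0 y0)).
- apply: eq_quadrant_Ck Cy => x y x0 y0.
  by case: (halfline_deriveE y0 (Dy _ _ x0 y0)).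
Qed.

Lemma quadrant_CkD k f g : quadrant_Ck k f -> quadrant_Ck k g ->
  quadrant_Ck k (fun x y => f x y + g x y).
Proof.
elim: k f g => [|k IH] f g Cf Cg.
  by split => //; apply: within_continuous_add; [case: Cf | case: Cg].
have [cf [_ f1 f2]] := Cf; have [cg [_ g1 g2]] := Cg.
apply: (quadrant_Ck_intro (fx := fun x y => D1 f x y + D1 g x y)
  (fy := fun x y => D2 f x y + D2 g x y)); [|move=> x y x0 y0..| |].
- exact: within_continuous_add.
- exact: derivative_withinD (quadrant_Ck_first Cf x0 y0) (quadrant_Ck_first Cg x0 y0).
- exact: derivative_withinD (quadrant_Ck_second Cf x0 y0) (quadrant_Ck_second Cg x0 y0).
- exact: IH.
- exact: IH.
Qed.

Lemma quadrant_CkZ k c f : quadrant_Ck k f -> quadrant_Ck k (fun x y => c * f x y).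
Proof.
elim: k f => [|k IH] f Cf.
  split => //; apply: within_continuousM; first exact: within_continuous_cst.
  by case: Cf.
have [cf [_ f1 f2]] := Cf.
apply: (quadrant_Ck_intro (fx := fun x y => c * D1 f x y)
  (fy := fun x y => c * D2 f x y)); [|move=> x y x0 y0..| |].
- by apply: within_continuousM => //; exact: within_continuous_cst.
- by apply: derivative_withinZ; exact: (quadrant_Ck_first Cf x0 y0).
- by apply: derivative_withinZ; exact: (quadrant_Ck_second Cf x0 y0).
- exact: IH.
- exact: IH.
Qed.

Lemma quadrant_CkMx k f : quadrant_Ck k f -> quadrant_Ck k (fun x y => x * f x y).
Proof.
have cx g : quadrant_continuous g -> quadrant_continuous (fun x y => x * g x y).
  move=> cg; apply: within_continuousM => //.
  by apply: continuous_subspaceT => z; exact: cvg_fst.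
elim: k f => [|k IH] f Cf; first by split => //; apply: cx; case: Cf.
have [cf [_ f1 f2]] := Cf.
apply: (quadrant_Ck_intro (fx := fun x y => f x y + x * D1 f x y)
  (fy := fun x y => x * D2 f x y)); [|move=> x y x0 y0..| |].
- exact: cx.
- by apply: (derivative_withinM_id (f := f ^~ y)); exact: (quadrant_Ck_first Cf x0 y0).
- by apply: derivative_withinZ; exact: (quadrant_Ck_second Cf x0 y0).
- by apply: quadrant_CkD; [exact: quadrant_CkS | exact: IH].
- exact: IH.
Qed.

Lemma quadrant_CkMy k f : quadrant_Ck k f -> quadrant_Ck k (fun x y => y * f x y).
Proof.
have cx g : quadrant_continuous g -> quadrant_continuous (fun x y => y * g x y).
  move=> cg; apply: within_continuousM => //.
  by apply: continuous_subspaceT => z; exact: cvg_snd.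
elim: k f => [|k IH] f Cf; first by split => //; apply: cx; case: Cf.
have [cf [_ f1 f2]] := Cf.
apply: (quadrant_Ck_intro (fx := fun x y => y * D1 f x y)
  (fy := fun x y => f x y + y * D2 f x y)); [|move=> x y x0 y0..| |].
- exact: cx.
- by apply: (derivative_withinZ (f := f ^~ y)); exact: (quadrant_Ck_first Cf x0 y0).
- by apply: derivative_withinM_id; exact: (quadrant_Ck_second Cf x0 y0).
- exact: IH.
- by apply: quadrant_CkD; [exact: quadrant_CkS | exact: IH].
Qed.

Lemma quadrant_smooth_first f : quadrant_smooth f -> quadrant_smooth (D1 f).
Proof. by move=> Sf k; case: (Sf k.+1) => _ []. Qed.

Lemma quadrant_smooth_second f : quadrant_smooth f -> quadrant_smooth (D2 f).
Proof. by move=> Sf k; case: (Sf k.+1) => _ []. Qed.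

Lemma coproduct_KplusE (s t : R) f x y :
  coproduct (Kcont s t Kplus) f x y = x * f x y + y * f x y.
Proof. by []. Qed.

Lemma coproduct_KminusE (s t : R) f x y :
  coproduct (Kcont s t Kminus) f x y = x * D1 (D1 f) x y + (s + t) * D1 f x y +
    (y * D2 (D2 f) x y + (s + t) * D2 f x y).
Proof. by []. Qed.

Lemma coproduct_KzeroE (s t : R) f x y :
  coproduct (Kcont s t Kzero) f x y = x * D1 f x y + (s + t) / 2 * f x y +
    (y * D2 f x y + (s + t) / 2 * f x y).
Proof. by []. Qed.

Lemma quadrant_smooth_Kcont (s t : R) a f : quadrant_smooth f ->
  quadrant_smooth (coproduct (Kcont s t a) f).
Proof.
move=> Sf k; have S1 := quadrant_smooth_first Sf; have S2 := quadrant_smooth_second Sf.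
have S11 := quadrant_smooth_first S1; have S22 := quadrant_smooth_second S2.
case: a.
- exact: quadrant_CkD (quadrant_CkMx (Sf k)) (quadrant_CkMy (Sf k)).
- exact: quadrant_CkD (quadrant_CkD (quadrant_CkMx (S11 k)) (quadrant_CkZ (s + t) (S1 k)))
    (quadrant_CkD (quadrant_CkMy (S22 k)) (quadrant_CkZ (s + t) (S2 k))).
- exact: quadrant_CkD (quadrant_CkD (quadrant_CkMx (S1 k)) (quadrant_CkZ ((s + t) / 2) (Sf k)))
    (quadrant_CkD (quadrant_CkMy (S2 k)) (quadrant_CkZ ((s + t) / 2) (Sf k))).
Qed.

Lemma eq_coproduct_Kcont (s t : R) a f g : eq_on_quadrant f g ->
  eq_on_quadrant (coproduct (Kcont s t a) f) (coproduct (Kcont s t a) g).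
Proof.
move=> fg; have fg1 := eq_first_derive fg; have fg2 := eq_second_derive fg.
have fg11 := eq_first_derive fg1; have fg22 := eq_second_derive fg2.
move=> x y x0 y0.
case: a; rewrite ?coproduct_KplusE ?coproduct_KminusE ?coproduct_KzeroE.
- by rewrite fg.
- by rewrite fg1 // fg2 // fg11 // fg22.
- by rewrite fg1 // fg2 // fg.
Qed.

End QuadrantCk.

(** * The continuous process *)

Section ContinuousMaps.
Variables (R : realType) (X : topologicalType).
Implicit Types f g : X -> R.

Lemma continuous_funD f g : continuous f -> continuous g -> continuous (fun x => f x + g x).
Proof. by move=> cf cg x; exact: cvgD (cf x) (cg x). Qed.

Lemma continuous_funN f : continuous f -> continuous (fun x => - f x).
Proof. by move=> cf x; exact: cvgN (cf x). Qed.

Lemma continuous_funM f g : continuous f -> continuous g -> continuous (fun x => f x * g x).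
Proof. by move=> cf cg x; exact: cvgM (cf x) (cg x). Qed.

Lemma continuous_fun_cst (c : R) : continuous (fun _ : X => c).
Proof. by move=> x; exact: cvg_cst. Qed.

Lemma continuous_fun_fst (U V : topologicalType) (f : X -> U * V) :
  continuous f -> continuous (fun x => (f x).1).
Proof. by move=> cf x; exact: (cvg_comp _ _ (cf x) cvg_fst). Qed.

Lemma continuous_fun_snd (U V : topologicalType) (f : X -> U * V) :
  continuous f -> continuous (fun x => (f x).2).
Proof. by move=> cf x; exact: (cvg_comp _ _ (cf x) cvg_snd). Qed.

End ContinuousMaps.

Lemma continuous_fun_id (X : topologicalType) : continuous (fun x : X => x).
Proof. by move=> x; exact: cvg_id. Qed.

Ltac continuous_poly :=
  lazymatch goal with
  | |- continuous (fun x => @?f x + @?g x) =>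
      apply: (@continuous_funD _ _ f g); continuous_poly
  | |- continuous (fun x => @?f x * @?g x) =>
      apply: (@continuous_funM _ _ f g); continuous_poly
  | |- continuous (fun x => - @?f x) => apply: (@continuous_funN _ _ f); continuous_poly
  | |- continuous (fun x => (@?f x).1) => apply: (continuous_fun_fst (f := f)); continuous_poly
  | |- continuous (fun x => (@?f x).2) => apply: (continuous_fun_snd (f := f)); continuous_poly
  | |- continuous (fun x => x) => exact: continuous_fun_id
  | |- _ => first [ assumption | exact: continuous_fun_cst | exact: continuous_fun_id
                  | exact: (continuous_fun_fst (@continuous_fun_id _))
                  | exact: (continuous_fun_snd (@continuous_fun_id _)) ]
  end.

Lemma mixed_ge0 (R : realType) (x y a b : R) :
  0 <= x -> 0 <= y -> `[0, 1]%classic a -> `[0, 1]%classic b ->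
  0 <= x * (1 - a) + y * b /\ 0 <= y * (1 - b) + x * a.
Proof.
move=> x0 y0; rewrite /= !in_itv/= => /andP[a0 a1] /andP[b0 b1].
by rewrite !addr_ge0 ?mulr_ge0 ?subr_ge0.
Qed.

(** * Weighted averages over the exchange and their derivatives *)

Section Mixing.
Variables (R : realType) (s t : R).
Hypotheses (s0 : 0 < s) (t0 : 0 < t).
Notation halfline := [set z : R | 0 <= z].
Notation seg := (`[0, 1]%classic : set R).
Notation square := (seg `*` seg).
Notation J := (beta_integral s t).
Notation D1 := (first_var (@halfline_derive R)).
Notation D2 := (second_var (@halfline_derive R)).
Notation quadrant_continuous f :=
  {within @quadrant R, continuous (fun z : R * R => f z.1 z.2)}.
Implicit Types (f g : R -> R -> R) (p : R * R -> R).

Definition beta_integral2 (F : R * R -> R) : R := J (fun v => J (fun u => F (u, v))).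
Notation I := beta_integral2.

Let bJ : bounded_functional seg J. Proof. exact: beta_integral_bounded. Qed.

Lemma beta_integral2_bounded : bounded_functional square I.
Proof. exact: (bounded_functional_prod (@segment_compact R 0 1) bJ bJ). Qed.
Let bI := beta_integral2_bounded.

Lemma compact_square : compact square.
Proof. by apply: compact_setX; exact: segment_compact. Qed.
Let csq := compact_square.

Definition mixed f (x y : R) (z : R * R) : R :=
  f (x * (1 - z.1) + y * z.2) (y * (1 - z.2) + x * z.1).

(** The weight makes the family closed under differentiation: by the chain rule, differentiating in
    [x] multiplies [p] by [1 - u] on the first partial and by [u] on the second; in [y] the factors
    are [v] and [1 - v]. *)
Definition mix p f (x y : R) : R := I (fun z => p z * mixed f x y z).

(** The parameter space is arbitrary, so that any of [x], [y], [z] may vary or stay fixed. *)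
Lemma mixed_continuous (X : topologicalType) (A : set X) (x y : X -> R) (z : X -> R * R) f p :
  continuous x -> continuous y -> continuous z -> continuous p ->
  (forall w, A w -> [/\ 0 <= x w, 0 <= y w & square (z w)]) ->
  quadrant_continuous f ->
  {within A, continuous (fun w => p (z w) * mixed f (x w) (y w) (z w))}.
Proof.
move=> cx cy cz cp Aq cf; apply: within_continuousM.
  by apply: continuous_subspaceT => w; exact: (cvg_comp _ _ (cz w) (cp _)).
apply: (within_continuous_precomp (g := fun w =>
  (x w * (1 - (z w).1) + y w * (z w).2, y w * (1 - (z w).2) + x w * (z w).1)) _ _ cf).
  by apply: continuous_pair; continuous_poly.
by move=> w /Aq[x0 y0 [z1 z2]]; exact: mixed_ge0.
Qed.

Lemma mixed_slice f p x y : 0 <= x -> 0 <= y -> continuous p -> quadrant_continuous f ->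
  {within square, continuous (fun z => p z * mixed f x y z)}.
Proof.
move=> x0 y0 cp cf.
by apply: (mixed_continuous (x := fun=> x) (y := fun=> y) (z := id)) => //;
  continuous_poly.
Qed.

Lemma mix_continuous p f : continuous p -> quadrant_continuous f ->
  quadrant_continuous (mix p f).
Proof.
move=> cp cf; apply: (functional_continuous csq bI (G := fun w z => p z * mixed f w.1 w.2 z)).
apply: (mixed_continuous (x := fun w : (R * R) * (R * R) => w.1.1) (y := fun w => w.1.2)
  (z := snd)) => //; try continuous_poly.
by move=> w [[? ?] ?].
Qed.

Lemma mixD p q f g x y : 0 <= x -> 0 <= y -> continuous p -> continuous q ->
  quadrant_continuous f -> quadrant_continuous g ->
  mix p f x y + mix q g x y = I (fun z => p z * mixed f x y z + q z * mixed g x y z).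
Proof. by move=> *; rewrite -(functionalD bI) //; exact: mixed_slice. Qed.

Lemma mix_first_derivative p f x y : continuous p -> quadrant_Ck 1 f ->
  0 <= x -> 0 <= y ->
  derivative_within halfline (mix p f ^~ y) x
    (mix (fun z => p z * (1 - z.1)) (D1 f) x y + mix (fun z => p z * z.1) (D2 f) x y).
Proof.
move=> cp Cf x0 y0; have [cf [_ [c1 _] [c2 _]]] := Cf.
rewrite mixD //; try continuous_poly.
apply: (functional_derivative csq bI (G := fun x z => p z * mixed f x y z)
  (G' := fun x z => p z * (1 - z.1) * mixed (D1 f) x y z + p z * z.1 * mixed (D2 f) x y z)) => //.
- exact: is_interval_halfline.
- by move=> x' x'0; exact: mixed_slice.
- move=> z [z1 z2] x' x'0; rewrite -!mulrA -mulrDr; apply: derivative_withinZ.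
  apply: (chain_rule_affine (quadrant_Ck_first Cf) (quadrant_Ck_second Cf) c1 c2
    (a := fun x => x * (1 - z.1) + y * z.2) (b := fun x => y * (1 - z.2) + x * z.1)) => //.
  + by move=> x'' x''0; case: (mixed_ge0 x''0 y0 z1 z2).
  + by move=> x'' x''0; case: (mixed_ge0 x''0 y0 z1 z2).
  + by move=> x'' h; ring.
  + by move=> x'' h; ring.
- apply: within_continuous_add.
  + apply: (mixed_continuous (x := fun w : R * (R * R) => w.1) (y := fun=> y) (z := snd)
      (p := fun z => p z * (1 - z.1))) => //; try continuous_poly.
    by move=> w [? ?].
  + apply: (mixed_continuous (x := fun w : R * (R * R) => w.1) (y := fun=> y) (z := snd)
      (p := fun z => p z * z.1)) => //; try continuous_poly.
    by move=> w [? ?].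
Qed.

Lemma mix_second_derivative p f x y : continuous p -> quadrant_Ck 1 f ->
  0 <= x -> 0 <= y ->
  derivative_within halfline (mix p f x) y
    (mix (fun z => p z * z.2) (D1 f) x y + mix (fun z => p z * (1 - z.2)) (D2 f) x y).
Proof.
move=> cp Cf x0 y0; have [cf [_ [c1 _] [c2 _]]] := Cf.
rewrite mixD //; try continuous_poly.
apply: (functional_derivative csq bI (G := fun y z => p z * mixed f x y z)
  (G' := fun y z => p z * z.2 * mixed (D1 f) x y z + p z * (1 - z.2) * mixed (D2 f) x y z)) => //.
- exact: is_interval_halfline.
- by move=> y' y'0; exact: mixed_slice.
- move=> z [z1 z2] y' y'0; rewrite -!mulrA -mulrDr; apply: derivative_withinZ.
  apply: (chain_rule_affine (quadrant_Ck_first Cf) (quadrant_Ck_second Cf) c1 c2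
    (a := fun y => x * (1 - z.1) + y * z.2) (b := fun y => y * (1 - z.2) + x * z.1)) => //.
  + by move=> y'' y''0; case: (mixed_ge0 x0 y''0 z1 z2).
  + by move=> y'' y''0; case: (mixed_ge0 x0 y''0 z1 z2).
  + by move=> y'' h; ring.
  + by move=> y'' h; ring.
- apply: within_continuous_add.
  + apply: (mixed_continuous (y := fun w : R * (R * R) => w.1) (x := fun=> x) (z := snd)
      (p := fun z => p z * z.2)) => //; try continuous_poly.
    by move=> w [? ?].
  + apply: (mixed_continuous (y := fun w : R * (R * R) => w.1) (x := fun=> x) (z := snd)
      (p := fun z => p z * (1 - z.2))) => //; try continuous_poly.
    by move=> w [? ?].
Qed.

Lemma mix_Ck k p f : continuous p -> quadrant_Ck k f -> quadrant_Ck k (mix p f).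
Proof.
(* [p] is generalised because the partial derivatives carry other weights. *)
elim: k p f => [|k IH] p f cp Cf.
  by split => //; apply: mix_continuous => //; case: Cf.
have C1 : quadrant_Ck 1 f.
  by elim: k {IH} Cf => [//|k IH] /quadrant_CkS.
have [cf [_ f1 f2]] := Cf.
apply: (quadrant_Ck_intro _ (fun x y => mix_first_derivative cp C1)
  (fun x y => mix_second_derivative cp C1)).
- exact: mix_continuous.
- by apply: quadrant_CkD; apply: IH => //; continuous_poly.
- by apply: quadrant_CkD; apply: IH => //; continuous_poly.
Qed.

End Mixing.

(** * Integration by parts in the unit square *)

Section ByParts.
Variables (R : realType) (s t : R).
Hypotheses (s0 : 0 < s) (t0 : 0 < t).
Notation seg := (`[0, 1]%classic : set R).
Notation square := (seg `*` seg).
Notation J := (beta_integral s t).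
Notation I := (beta_integral2 s t).
Notation D1 := (first_var (@halfline_derive R)).
Notation D2 := (second_var (@halfline_derive R)).
Variables (e : R -> R -> R) (x y : R).
Hypotheses (Ce : quadrant_Ck 1 e) (x0 : 0 <= x) (y0 : 0 <= y).
Let bJ : bounded_functional seg J := beta_integral_bounded s0 t0.
Let bI : bounded_functional square I := beta_integral2_bounded s0 t0.
Let Ce0 := quadrant_Ck_continuous Ce.
Let C1 : {within @quadrant R, continuous (fun z : R * R => D1 e z.1 z.2)}.
Proof. by case: Ce => _ [_ []]. Qed.
Let C2 : {within @quadrant R, continuous (fun z : R * R => D2 e z.1 z.2)}.
Proof. by case: Ce => _ [_ _ []]. Qed.
Notation E u v := (mixed e x y (u, v)).
Notation dE u v := (mixed (D1 e) x y (u, v) - mixed (D2 e) x y (u, v)).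

Let is_interval_seg : is_interval seg.
Proof. exact: interval_is_interval. Qed.

Let mixed_cont (X : topologicalType) (A : set X) (z : X -> R * R)
    (p : R * R -> R) (f : R -> R -> R) :
  continuous z -> continuous p -> (forall w, A w -> square (z w)) ->
  {within @quadrant R, continuous (fun z : R * R => f z.1 z.2)} ->
  {within A, continuous (fun w => p (z w) * mixed f x y (z w))}.
Proof.
move=> cz cp Aq cf; apply: (mixed_continuous (x := fun=> x) (y := fun=> y)) => //.
- exact: continuous_fun_cst.
- exact: continuous_fun_cst.
- by move=> w /Aq.
Qed.

Let dE_cont (X : topologicalType) (A : set X) (z : X -> R * R) (p : R * R -> R) :
  continuous z -> continuous p -> (forall w, A w -> square (z w)) ->
  {within A, continuous (fun w => p (z w) * (mixed (D1 e) x y (z w) - mixed (D2 e) x y (z w)))}.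
Proof.
move=> cz cp Aq.
apply: (eq_within_continuous (f := fun w => p (z w) * mixed (D1 e) x y (z w) +
   (- p (z w)) * mixed (D2 e) x y (z w))).
  by move=> w _; ring.
apply: within_continuous_add; first exact: mixed_cont.
by apply: (mixed_cont (p := fun z => - p z)) => //; continuous_poly.
Qed.

(** Here [u] is the inner variable: for each fixed [v] the inner integral is already 0. *)
Lemma beta_integral2_by_parts_fst :
  I (fun z => (s - (s + t) * z.1) * E z.1 z.2 + z.1 * (1 - z.1) * (- x * dE z.1 z.2)) = 0.
Proof.
rewrite /beta_integral2 -[RHS](functional0 bJ); symmetry.
apply: (eq_functional bJ); first exact: within_continuous_cst.
move=> v v01 /=; symmetry.
apply: (beta_integral_by_parts s0 t0 (g := fun u => E u v) (g' := fun u => - x * dE u v)).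
- move=> u u01.
  have -> : - x * dE u v = - x * mixed (D1 e) x y (u, v) + x * mixed (D2 e) x y (u, v) by ring.
  apply: (chain_rule_affine (quadrant_Ck_first Ce) (quadrant_Ck_second Ce) C1 C2
    (a := fun u => x * (1 - u) + y * v) (b := fun u => y * (1 - v) + x * u)) => //.
  + by move=> u' u'01; case: (mixed_ge0 x0 y0 u'01 v01).
  + by move=> u' u'01; case: (mixed_ge0 x0 y0 u'01 v01).
  + by move=> u' h; ring.
  + by move=> u' h; ring.
- apply: (dE_cont (z := fun u => (u, v)) (p := fun=> - x)) => //.
  by apply: continuous_pair; continuous_poly.
  exact: continuous_fun_cst.
Qed.

(** Since [v] is the outer variable, the function integrated by parts is the inner integral of [E]
    over [u], differentiated in [v] under the functional. Linearity then moves the factors in [v]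
    inside. *)
Lemma beta_integral2_by_parts_snd :
  I (fun z => (s - (s + t) * z.2) * E z.1 z.2 + z.2 * (1 - z.2) * (y * dE z.1 z.2)) = 0.
Proof.
have sl v : seg v -> {within seg, continuous (fun u => 1 * E u v)}.
  move=> v01; apply: (mixed_cont (z := fun u => (u, v)) (p := fun=> 1)) => //.
  by apply: continuous_pair; continuous_poly.
  exact: continuous_fun_cst.
have sl1 v : seg v -> {within seg, continuous (fun u => E u v)}.
  by move=> /sl; apply: eq_within_continuous => u _; rewrite mul1r.
have dsl v : seg v -> {within seg, continuous (fun u => y * dE u v)}.
  move=> v01; apply: (dE_cont (z := fun u => (u, v)) (p := fun=> y)) => //.
  by apply: continuous_pair; continuous_poly.
  exact: continuous_fun_cst.
have swap : continuous (fun w : R * R => (w.2, w.1)).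
  by apply: continuous_pair; continuous_poly.
have djoint : {within square, continuous (fun w : R * R => y * dE w.2 w.1)}.
  by apply: (dE_cont (z := fun w => (w.2, w.1)) (p := fun=> y)) => //;
    [exact: continuous_fun_cst | move=> w []].
have cH' : {within seg, continuous (fun v => J (fun u => y * dE u v))}.
  exact: (functional_continuous (@segment_compact R 0 1) bJ (G := fun v u => y * dE u v)).
have dH v : seg v ->
    derivative_within seg (fun v => J (fun u => E u v)) v (J (fun u => y * dE u v)).
  move=> v01.
  apply: (functional_derivative (@segment_compact R 0 1) bJ (G := fun v u => E u v)
    (G' := fun v u => y * dE u v)) => // u u01 v' v'01.
  have -> : y * dE u v' = y * mixed (D1 e) x y (u, v') + (- y) * mixed (D2 e) x y (u, v') by ring.
  apply: (chain_rule_affine (quadrant_Ck_first Ce) (quadrant_Ck_second Ce) C1 C2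
    (a := fun v => x * (1 - u) + y * v) (b := fun v => y * (1 - v) + x * u)) => //.
  + by move=> w w01; case: (mixed_ge0 x0 y0 u01 w01).
  + by move=> w w01; case: (mixed_ge0 x0 y0 u01 w01).
  + by move=> w h; ring.
  + by move=> w h; ring.
rewrite -(beta_integral_by_parts s0 t0 dH cH') /beta_integral2; symmetry.
apply: (eq_functional bJ).
  have cH : {within seg, continuous (fun v => J (fun u => E u v))}.
    by apply/within_continuousP => v v01; exact: derivative_within_continuous (dH v v01).
  by apply: within_continuous_add; apply: within_continuousM => //;
    apply: continuous_subspaceT; continuous_poly.
move=> v v01 /=; have c1 := sl1 v v01; have c2 := dsl v v01.
rewrite -(functionalZ bJ _ c1) -(functionalZ bJ _ c2) -(functionalD bJ) //.
  by apply: within_continuousM => //; exact: within_continuous_cst.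
by apply: within_continuousM => //; exact: within_continuous_cst.
Qed.

(* As [d/du E = - x dE] and [d/dv E = y dE], the difference of the two
   integrations by parts involves [E] only through [(u - v) E]. *)
Lemma beta_integral2_by_parts :
  I (fun z => (x * (z.1 * (1 - z.1)) + y * (z.2 * (1 - z.2))) * dE z.1 z.2 +
     (s + t) * (z.1 - z.2) * E z.1 z.2) = 0.
Proof.
have cid : continuous (fun z : R * R => z) by exact: continuous_fun_id.
have cE (p : R * R -> R) : continuous p ->
    {within square, continuous (fun z : R * R => p z * E z.1 z.2)}.
  by move=> cp; apply: eq_within_continuous (mixed_cont cid cp _ Ce0) => // -[].
have cdE (p : R * R -> R) : continuous p ->
    {within square, continuous (fun z : R * R => p z * dE z.1 z.2)}.
  by move=> cp; apply: eq_within_continuous (dE_cont cid cp _) => // -[].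
have cA : {within square, continuous (fun z : R * R =>
    (s - (s + t) * z.1) * E z.1 z.2 + z.1 * (1 - z.1) * (- x * dE z.1 z.2))}.
  apply: within_continuous_add; first by apply: cE; continuous_poly.
  apply: eq_within_continuous (cdE (fun z => z.1 * (1 - z.1) * - x) _).
    by move=> z _ /=; ring.
  by continuous_poly.
have cB : {within square, continuous (fun z : R * R =>
    (s - (s + t) * z.2) * E z.1 z.2 + z.2 * (1 - z.2) * (y * dE z.1 z.2))}.
  apply: within_continuous_add; first by apply: cE; continuous_poly.
  apply: eq_within_continuous (cdE (fun z => z.2 * (1 - z.2) * y) _).
    by move=> z _ /=; ring.
  by continuous_poly.
have := functionalB bI cB cA.
rewrite beta_integral2_by_parts_fst beta_integral2_by_parts_snd subrr => <-.
by congr I; apply/funext => z; ring.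
Qed.

End ByParts.

(** * Commutation of the continuous generator *)

Section ContinuousSymmetry.
Variables (R : realType) (s t : R).
Hypotheses (s0 : 0 < s) (t0 : 0 < t).
Notation seg := (`[0, 1]%classic : set R).
Notation square := (seg `*` seg).
Notation J := (beta_integral s t).
Notation I := (beta_integral2 s t).
Notation mix1 := (mix s t (fun=> 1)).
Notation D1 := (first_var (@halfline_derive R)).
Notation D2 := (second_var (@halfline_derive R)).
Notation quadrant_continuous f :=
  {within @quadrant R, continuous (fun z : R * R => f z.1 z.2)}.
Implicit Types f g : R -> R -> R.
Let bJ : bounded_functional seg J := beta_integral_bounded s0 t0.
Let bI : bounded_functional square I := beta_integral2_bounded s0 t0.
Let c1 : continuous (fun _ : R * R => 1 : R) := @continuous_fun_cst R _ 1.

(** Splits the generator into an average and a multiple of the identity. The latter commutes with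
    every linear operator whatever the constant [I 1] is, so the commutation rests on [mix1]. *)
Lemma LcontE f x y : quadrant_continuous f -> 0 <= x -> 0 <= y ->
  Lcont s t f x y = (Beta s t ^+ 2)^-1 * (mix1 f x y - I (fun=> 1) * f x y).
Proof.
move=> cf x0 y0; set c := (Beta s t ^+ 2)^-1.
pose F z := 1 * mixed f x y z - f x y * 1.
have cmix : {within square, continuous (fun z => 1 * mixed f x y z)}.
  exact: (mixed_slice x0 y0 c1 cf).
have ccst : {within square, continuous (fun z : R * R => f x y * 1)}.
  exact: within_continuous_cst.
have cF : {within square, continuous F} by move=> z; apply: cvgB; [exact: cmix|exact: ccst].
have -> : mix1 f x y - I (fun=> 1) * f x y = I F.
  rewrite /F (functionalB bI cmix ccst) (functionalZ bI (f x y) (f := fun=> 1)) 1?mulrC //.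
  exact: within_continuous_cst.
have sl v : seg v -> {within seg, continuous (fun u => F (u, v))}.
  move=> v01; apply: (within_continuous_precomp (g := fun u => (u, v)) _ _ cF) => //.
  by apply: continuous_pair; continuous_poly.
have cJ : {within seg, continuous (fun v => J (fun u => F (u, v)))}.
  apply: (functional_continuous (@segment_compact R 0 1) bJ (G := fun v u => F (u, v))).
  apply: (within_continuous_precomp (g := fun w : R * R => (w.2, w.1)) _ _ cF) => [|w []//].
  by apply: continuous_pair; continuous_poly.
rewrite /beta_integral2 [in RHS]/beta_integral.
rewrite -(RintegralZl _ _ (beta_integrand_integrable s0 t0 cJ)) //.
apply: eq_Rintegral => v; rewrite inE => v01.
have iv := beta_integrand_integrable s0 t0 (sl v (subset_itv_oo_cc v01)).
transitivity (\int[@lebesgue_measure R]_(u in `]0, 1[)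
    (F (u, v) * beta_density s t u * (c * beta_density s t v))).
  by apply: eq_Rintegral => u _; rewrite /F /mixed /phi /beta_density -/c /=; ring.
by rewrite (RintegralZr _ _ iv) // mulrCA.
Qed.

Lemma quadrant_smooth_mix f : quadrant_smooth f -> quadrant_smooth (mix1 f).
Proof. by move=> Sf k; exact: mix_Ck. Qed.

Lemma quadrant_smooth_Lcont f : quadrant_smooth f -> quadrant_smooth (Lcont s t f).
Proof.
move=> Sf k; pose c := (Beta s t ^+ 2)^-1.
apply: (eq_quadrant_Ck (f := fun x y => c * (mix1 f x y + (- I (fun=> 1)) * f x y))).
  by move=> x y x0 y0; rewrite LcontE ?mulNr //; exact: (quadrant_Ck_continuous (Sf 0%N)).
apply: quadrant_CkZ; apply: quadrant_CkD; first exact: quadrant_smooth_mix.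
exact: quadrant_CkZ.
Qed.

Lemma mix_first_deriveE p f x y : continuous p -> quadrant_Ck 1 f -> 0 <= x -> 0 <= y ->
  D1 (mix s t p f) x y = mix s t (fun z => p z * (1 - z.1)) (D1 f) x y +
    mix s t (fun z => p z * z.1) (D2 f) x y.
Proof.
by move=> cp Cf x0 y0; case: (halfline_deriveE x0 (mix_first_derivative s0 t0 cp Cf x0 y0)).
Qed.

Lemma mix_second_deriveE p f x y : continuous p -> quadrant_Ck 1 f -> 0 <= x -> 0 <= y ->
  D2 (mix s t p f) x y = mix s t (fun z => p z * z.2) (D1 f) x y +
    mix s t (fun z => p z * (1 - z.2)) (D2 f) x y.
Proof.
by move=> cp Cf x0 y0; case: (halfline_deriveE y0 (mix_second_derivative s0 t0 cp Cf x0 y0)).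
Qed.

Lemma first_deriveD f g x y : quadrant_Ck 1 f -> quadrant_Ck 1 g -> 0 <= x -> 0 <= y ->
  D1 (fun x y => f x y + g x y) x y = D1 f x y + D1 g x y.
Proof.
move=> Cf Cg x0 y0.
by case: (halfline_deriveE x0 (derivative_withinD (quadrant_Ck_first Cf x0 y0)
  (quadrant_Ck_first Cg x0 y0))).
Qed.

Lemma second_deriveD f g x y : quadrant_Ck 1 f -> quadrant_Ck 1 g -> 0 <= x -> 0 <= y ->
  D2 (fun x y => f x y + g x y) x y = D2 f x y + D2 g x y.
Proof.
move=> Cf Cg x0 y0.
by case: (halfline_deriveE y0 (derivative_withinD (quadrant_Ck_second Cf x0 y0)
  (quadrant_Ck_second Cg x0 y0))).
Qed.

Lemma first_deriveZ c f x y : quadrant_Ck 1 f -> 0 <= x -> 0 <= y ->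
  D1 (fun x y => c * f x y) x y = c * D1 f x y.
Proof.
move=> Cf x0 y0.
by case: (halfline_deriveE x0 (derivative_withinZ (c := c) (quadrant_Ck_first Cf x0 y0))).
Qed.

Lemma second_deriveZ c f x y : quadrant_Ck 1 f -> 0 <= x -> 0 <= y ->
  D2 (fun x y => c * f x y) x y = c * D2 f x y.
Proof.
move=> Cf x0 y0.
by case: (halfline_deriveE y0 (derivative_withinZ (c := c) (quadrant_Ck_second Cf x0 y0))).
Qed.

(** Smoothness enters because [halfline_derive] is a limit, additive where the difference quotients
    converge. *)
Lemma coproduct_KcontD a f g x y : quadrant_smooth f -> quadrant_smooth g ->
  0 <= x -> 0 <= y ->
  coproduct (Kcont s t a) (fun x y => f x y + g x y) x y =
  coproduct (Kcont s t a) f x y + coproduct (Kcont s t a) g x y.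
Proof.
move=> Sf Sg x0 y0.
have [f1 f2] := (quadrant_smooth_first Sf, quadrant_smooth_second Sf).
have [g1 g2] := (quadrant_smooth_first Sg, quadrant_smooth_second Sg).
have E1 := fun x y => @first_deriveD f g x y (Sf 1%N) (Sg 1%N).
have E2 := fun x y => @second_deriveD f g x y (Sf 1%N) (Sg 1%N).
have E11 : D1 (D1 (fun x y => f x y + g x y)) x y = D1 (D1 f) x y + D1 (D1 g) x y.
  by rewrite (eq_first_derive E1) // first_deriveD.
have E22 : D2 (D2 (fun x y => f x y + g x y)) x y = D2 (D2 f) x y + D2 (D2 g) x y.
  by rewrite (eq_second_derive E2) // second_deriveD.
have {}E1 := E1 x y x0 y0; have {}E2 := E2 x y x0 y0.
case: a; rewrite ?coproduct_KplusE ?coproduct_KminusE ?coproduct_KzeroE.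
- ring.
- rewrite E1 E2 E11 E22; ring.
- rewrite E1 E2; ring.
Qed.

Lemma coproduct_KcontZ a c f x y : quadrant_smooth f -> 0 <= x -> 0 <= y ->
  coproduct (Kcont s t a) (fun x y => c * f x y) x y = c * coproduct (Kcont s t a) f x y.
Proof.
move=> Sf x0 y0.
have [f1 f2] := (quadrant_smooth_first Sf, quadrant_smooth_second Sf).
have E1 := fun x y => @first_deriveZ c f x y (Sf 1%N).
have E2 := fun x y => @second_deriveZ c f x y (Sf 1%N).
have E11 : D1 (D1 (fun x y => c * f x y)) x y = c * D1 (D1 f) x y.
  by rewrite (eq_first_derive E1) // first_deriveZ.
have E22 : D2 (D2 (fun x y => c * f x y)) x y = c * D2 (D2 f) x y.
  by rewrite (eq_second_derive E2) // second_deriveZ.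
have {}E1 := E1 x y x0 y0; have {}E2 := E2 x y x0 y0.
case: a; rewrite ?coproduct_KplusE ?coproduct_KminusE ?coproduct_KzeroE.
- ring.
- rewrite E1 E2 E11 E22; ring.
- rewrite E1 E2; ring.
Qed.

Lemma mix_Kcont a f x y : quadrant_smooth f -> 0 <= x -> 0 <= y ->
  mix1 (coproduct (Kcont s t a) f) x y = coproduct (Kcont s t a) (mix1 f) x y.
Proof.
move=> Sf x0 y0.
have [S1 S2] := (quadrant_smooth_first Sf, quadrant_smooth_second Sf).
pose m (p : R * R -> R) g z := p z * mixed g x y z.
have cm p g : continuous p -> quadrant_smooth g -> {within square, continuous (m p g)}.
  by move=> cp Sg; apply: mixed_slice => //; exact: (quadrant_Ck_continuous (Sg 0%N)).
have mixE p g : mix s t p g x y = I (m p g) by [].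
have cK := cm _ _ c1 (quadrant_smooth_Kcont s t a Sf).
have cf := cm _ _ c1 Sf.
have ccst c : {within square, continuous (fun _ : R * R => c : R)}.
  exact: within_continuous_cst.
have c1B : continuous (fun z : R * R => 1 * (1 - z.1)) by continuous_poly.
have c1u : continuous (fun z : R * R => 1 * z.1) by continuous_poly.
have c1v : continuous (fun z : R * R => 1 * z.2) by continuous_poly.
have c1C : continuous (fun z : R * R => 1 * (1 - z.2)) by continuous_poly.
(* Presents a number as one integral of a continuous function. Once both sides are presented so,
   their difference is a single [I], and the claim reduces to integrands. *)
pose repr r F := {within square, continuous F} /\ r = I F.
have reprD r r' F F' : repr r F -> repr r' F' -> repr (r + r') (fun z => F z + F' z).
  move=> [cF ->] [cF' ->]; split; first exact: within_continuous_add.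
  by rewrite (functionalD bI).
have reprZ c r F : repr r F -> repr (c * r) (fun z => c * F z).
  move=> [cF ->]; split; first exact: within_continuousM.
  by rewrite (functionalZ bI).
have reprm p g (cp : continuous p) (Sg : quadrant_smooth g) :
  repr (mix s t p g x y) (m p g) := conj (cm p g cp Sg) erefl.
have cfst (p : R * R -> R) : continuous p -> continuous (fun z => p z * z.1).
  by move=> cp; continuous_poly.
have cfst1 (p : R * R -> R) : continuous p -> continuous (fun z => p z * (1 - z.1)).
  by move=> cp; continuous_poly.
have csnd (p : R * R -> R) : continuous p -> continuous (fun z => p z * z.2).
  by move=> cp; continuous_poly.
have csnd1 (p : R * R -> R) : continuous p -> continuous (fun z => p z * (1 - z.2)).
  by move=> cp; continuous_poly.
have repr_fst p g : continuous p -> quadrant_smooth g ->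
    repr (D1 (mix s t p g) x y)
      (fun z => m (fun z => p z * (1 - z.1)) (D1 g) z + m (fun z => p z * z.1) (D2 g) z).
  move=> cp Sg; rewrite (mix_first_deriveE cp (Sg 1%N) x0 y0).
  exact: (reprD _ _ _ _ (reprm _ _ (cfst1 _ cp) (quadrant_smooth_first Sg))
    (reprm _ _ (cfst _ cp) (quadrant_smooth_second Sg))).
have repr_snd p g : continuous p -> quadrant_smooth g ->
    repr (D2 (mix s t p g) x y)
      (fun z => m (fun z => p z * z.2) (D1 g) z + m (fun z => p z * (1 - z.2)) (D2 g) z).
  move=> cp Sg; rewrite (mix_second_deriveE cp (Sg 1%N) x0 y0).
  exact: (reprD _ _ _ _ (reprm _ _ (csnd _ cp) (quadrant_smooth_first Sg))
    (reprm _ _ (csnd1 _ cp) (quadrant_smooth_second Sg))).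
case: a cK => cK.
- rewrite coproduct_KplusE -mulrDl mixE -(functionalZ bI _ cf).
  congr I; apply/funext => z; rewrite /m /mixed coproduct_KplusE; ring.
- have F1 : eq_on_quadrant (D1 (mix1 f)) (fun x y =>
      mix s t (fun z => 1 * (1 - z.1)) (D1 f) x y + mix s t (fun z => 1 * z.1) (D2 f) x y).
    by move=> x' y' x'0 y'0; exact: (mix_first_deriveE c1 (Sf 1%N)).
  have F2 : eq_on_quadrant (D2 (mix1 f)) (fun x y =>
      mix s t (fun z => 1 * z.2) (D1 f) x y + mix s t (fun z => 1 * (1 - z.2)) (D2 f) x y).
    by move=> x' y' x'0 y'0; exact: (mix_second_deriveE c1 (Sf 1%N)).
  have M p g : continuous p -> quadrant_smooth g -> quadrant_Ck 1 (mix s t p g).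
    by move=> cp Sg; exact: mix_Ck.
  rewrite coproduct_KminusE (eq_first_derive F1) // (eq_second_derive F2) // F1 // F2 //.
  rewrite first_deriveD ?second_deriveD //; try exact: M.
  have [S11 S12] := (quadrant_smooth_first S1, quadrant_smooth_first S2).
  have [S21 S22] := (quadrant_smooth_second S1, quadrant_smooth_second S2).
  have [cR ER] := reprD _ _ _ _
    (reprD _ _ _ _ (reprZ x _ _ (reprD _ _ _ _ (repr_fst _ _ c1B S1) (repr_fst _ _ c1u S2)))
      (reprZ (s + t) _ _ (reprD _ _ _ _ (reprm _ _ c1B S1) (reprm _ _ c1u S2))))
    (reprD _ _ _ _ (reprZ y _ _ (reprD _ _ _ _ (repr_snd _ _ c1v S1) (repr_snd _ _ c1C S2)))
      (reprZ (s + t) _ _ (reprD _ _ _ _ (reprm _ _ c1v S1) (reprm _ _ c1C S2)))).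
  apply: etrans (esym ER).
  rewrite mixE; apply/eqP; rewrite -subr_eq0 -(functionalB bI cK cR).
  (* The function to integrate by parts is [(d1 - d2) f], written with [-1 *] to fit the closure
     lemmas for sums and multiples. *)
  pose e x y := D1 f x y + -1 * D2 f x y.
  have SN : quadrant_smooth (fun x y => -1 * D2 f x y) by move=> k; exact: quadrant_CkZ.
  have Se : quadrant_smooth e by move=> k; exact: quadrant_CkD.
  (* The right-hand 0 becomes the integral that vanishes by parts; what remains is a pointwise
     identity of integrands. *)
  rewrite -(beta_integral2_by_parts s0 t0 (Se 1%N) x0 y0); apply/eqP.
  apply: (eq_functional bI).
    by move=> z; apply: cvgB; [exact: cK | exact: cR].
  move=> [u v] [/= u01 v01]; rewrite /m /mixed /= coproduct_KminusE.
  have [X0 Y0] := mixed_ge0 x0 y0 u01 v01.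
  have D1e X Y : 0 <= X -> 0 <= Y -> D1 e X Y = D1 (D1 f) X Y + -1 * D1 (D2 f) X Y.
    by move=> X0' Y0'; rewrite first_deriveD // first_deriveZ.
  have D2e X Y : 0 <= X -> 0 <= Y -> D2 e X Y = D2 (D1 f) X Y + -1 * D2 (D2 f) X Y.
    by move=> X0' Y0'; rewrite second_deriveD // second_deriveZ.
  rewrite D1e // D2e // /e.
  (* The two orders of mixed derivative become distinct atoms, each occurring with the same
     coefficient on both sides. *)
  move: (D1 (D1 f) _ _) (D1 (D2 f) _ _) (D2 (D1 f) _ _) (D2 (D2 f) _ _) (D1 f _ _) (D2 f _ _).
  by move=> *; ring.
- rewrite coproduct_KzeroE (mix_first_deriveE c1 (Sf 1%N)) //.
  rewrite (mix_second_deriveE c1 (Sf 1%N)) //.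
  have [cR ER] := reprD _ _ _ _
    (reprD _ _ _ _ (reprZ x _ _ (reprD _ _ _ _ (reprm _ _ c1B S1) (reprm _ _ c1u S2)))
      (reprZ ((s + t) / 2) _ _ (reprm _ _ c1 Sf)))
    (reprD _ _ _ _ (reprZ y _ _ (reprD _ _ _ _ (reprm _ _ c1v S1) (reprm _ _ c1C S2)))
      (reprZ ((s + t) / 2) _ _ (reprm _ _ c1 Sf))).
  apply: etrans (esym ER).
  rewrite mixE; congr I; apply/funext => z; rewrite /m /mixed coproduct_KzeroE.
  by move: (D1 f _ _) (D2 f _ _) (f _ _) => *; ring.
Qed.

Lemma Lcont_Kcont a f x y : quadrant_smooth f -> 0 <= x -> 0 <= y ->
  Lcont s t (coproduct (Kcont s t a) f) x y = coproduct (Kcont s t a) (Lcont s t f) x y.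
Proof.
move=> Sf x0 y0; set c := (Beta s t ^+ 2)^-1.
have SKf := quadrant_smooth_Kcont s t a Sf.
have SP := quadrant_smooth_mix Sf.
rewrite LcontE //; last exact: (quadrant_Ck_continuous (SKf 0%N)).
rewrite mix_Kcont // -/c.
have E : eq_on_quadrant (Lcont s t f)
    (fun x y => c * mix1 f x y + (- (c * I (fun=> 1))) * f x y).
  move=> x' y' x'0 y'0; rewrite LcontE //; last exact: (quadrant_Ck_continuous (Sf 0%N)).
  by rewrite -/c; ring.
rewrite (eq_coproduct_Kcont s t a E) // coproduct_KcontD //; last 2 first.
- by move=> k; apply: quadrant_CkZ.
- by move=> k; apply: quadrant_CkZ.
by rewrite !coproduct_KcontZ //; ring.
Qed.

Lemma LcontD f g x y : quadrant_smooth f -> quadrant_smooth g -> 0 <= x -> 0 <= y ->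
  Lcont s t (f + g) x y = Lcont s t f x y + Lcont s t g x y.
Proof.
move=> Sf Sg x0 y0; have cf := quadrant_Ck_continuous (Sf 0%N).
have cg := quadrant_Ck_continuous (Sg 0%N).
rewrite !LcontE //; last exact: within_continuous_add.
have -> : mix1 (f + g) x y = mix1 f x y + mix1 g x y.
  have mD z : mixed (f + g) x y z = mixed f x y z + mixed g x y z by [].
  rewrite (mixD s0 t0 x0 y0 c1 c1 cf cg) /mix.
  by congr (beta_integral2 s t _); apply/funext => z; rewrite mD mulrDr.
have -> : (f + g) x y = f x y + g x y by [].
by move: (mix1 f x y) (mix1 g x y) (I _) (Beta s t) => *; ring.
Qed.

Lemma LcontZ c f x y : quadrant_smooth f -> 0 <= x -> 0 <= y ->
  Lcont s t (c *: f) x y = c * Lcont s t f x y.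
Proof.
move=> Sf x0 y0; have cf := quadrant_Ck_continuous (Sf 0%N).
rewrite !LcontE //; last first.
  by apply: within_continuousM => //; exact: within_continuous_cst.
have -> : mix1 (c *: f) x y = c * mix1 f x y.
  rewrite -(functionalZ bI); last exact: mixed_slice.
  congr I; apply/funext => z; rewrite /mixed /= mulrCA; congr (_ * _).
have -> : (c *: f) x y = c * f x y by [].
ring.
Qed.

(** Composition dictates the strengthened induction: moving [Lcont] past [A] in [A \o B] requires
    [B f] to be smooth, and applying [A] to the identity for [B], known on the quadrant only,
    requires [A] to respect such equalities. *)
Lemma generated_algebra_Kcont (A : (R -> R -> R) -> R -> R -> R) :
  generated_algebra (range (fun a => coproduct (Kcont s t a))) A ->
  (forall f g, eq_on_quadrant f g -> eq_on_quadrant (A f) (A g)) /\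
  forall f, quadrant_smooth f -> quadrant_smooth (A f) /\
    eq_on_quadrant (Lcont s t (A f)) (A (Lcont s t f)).
Proof.
elim=> {A} [A [a _ <-]| |A B _ [eA HA] _ [eB HB]|c A _ [eA HA]|A B _ [eA HA] _ [eB HB]].
- split=> [f g|f Sf]; first exact: eq_coproduct_Kcont.
  by split; [exact: quadrant_smooth_Kcont | move=> x y x0 y0; exact: Lcont_Kcont].
- by split.
- split=> [f g fg x y x0 y0|f Sf]; first by rewrite /= !fctE (eA _ _ fg) // (eB _ _ fg).
  have [[SA LA] [SB LB]] := (HA f Sf, HB f Sf).
  split; first by move=> k; exact: quadrant_CkD.
  by move=> x y x0 y0; rewrite LcontD // LA // LB.
- split=> [f g fg x y x0 y0|f Sf].
    by rewrite -[LHS]/(c * A f x y) -[RHS]/(c * A g x y) (eA _ _ fg).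
  have [SA LA] := HA f Sf.
  split; first by move=> k; exact: quadrant_CkZ.
  by move=> x y x0 y0; rewrite LcontZ // LA.
- split=> [f g fg|f Sf]; first exact/eA/eB.
  have [SB LB] := HB f Sf; have [SA LA] := HA _ SB.
  split=> // x y x0 y0; rewrite /= LA //; exact: eA.
Qed.

End ContinuousSymmetry.

Lemma generated_algebra_Kdisc (R : realType) (s t : R) (s0 : 0 < s) (t0 : 0 < t)
    (A : (nat -> nat -> R) -> nat -> nat -> R) :
  generated_algebra (range (fun a => coproduct (Kdisc s t a))) A ->
  forall f, Ldisc s t (A f) = A (Ldisc s t f).
Proof.
elim=> {A} [A [a _ <-] f| //|A B _ HA _ HB f|c A _ HA f|A B _ HA _ HB f].
- by apply/eqP; rewrite -subr_eq0; apply/eqP; exact: Ldisc_Kdisc.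
- rewrite /= -HA -HB; apply/funext => n; apply/funext => m.
  rewrite !fctE /Ldisc -big_split; apply: eq_bigr => k _.
  by rewrite -big_split; apply: eq_bigr => l _ /=; rewrite !fctE; ring.
- rewrite -HA; apply/funext => n; apply/funext => m.
  rewrite -[RHS]/(c * Ldisc s t (A f) n m) /Ldisc mulr_sumr; apply: eq_bigr => k _.
  rewrite mulr_sumr; apply: eq_bigr => l _.
  rewrite -[X in _ * X]/(c * A f (n - k + l)%N (m - l + k)%N - c * A f n m).
  by rewrite -mulrBr mulrCA.
- by rewrite /= HA HB.
Qed.

(* The smoothness clauses say that the continuous operators act on smooth
   functions, so that the compositions in the commutators are meaningful. *)
Theorem theorem6p2 (R : realType) (s t : R) (s_gt0 : 0 < s) (t_gt0 : 0 < t) :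
  [/\ (forall (a : su11) (f : nat -> nat -> R),
         commutator (Ldisc s t) (coproduct (Kdisc s t a)) f = 0),
      (forall f : R -> R -> R, quadrant_smooth f ->
         quadrant_smooth (Lcont s t f) /\
         forall a : su11,
           quadrant_smooth (coproduct (Kcont s t a) f) /\
           forall x y : R, 0 <= x -> 0 <= y ->
             commutator (Lcont s t) (coproduct (Kcont s t a)) f x y = 0),
      (forall A : (nat -> nat -> R) -> nat -> nat -> R,
         generated_algebra (range (fun a => coproduct (Kdisc s t a))) A ->
         forall f : nat -> nat -> R, commutator (Ldisc s t) A f = 0)
    & (forall A : (R -> R -> R) -> R -> R -> R,
         generated_algebra (range (fun a => coproduct (Kcont s t a))) A ->
         forall f : R -> R -> R, quadrant_smooth f ->
           quadrant_smooth (A f) /\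
           forall x y : R, 0 <= x -> 0 <= y ->
             commutator (Lcont s t) A f x y = 0)].
Proof.
split.
- by move=> a f; exact: Ldisc_Kdisc.
- move=> f Sf; split; first exact: quadrant_smooth_Lcont.
  move=> a; split; first exact: quadrant_smooth_Kcont.
  by move=> x y x0 y0; apply/eqP; rewrite subr_eq0; apply/eqP; exact: Lcont_Kcont.
- move=> A gA f; apply/eqP; rewrite subr_eq0; apply/eqP.
  exact: generated_algebra_Kdisc.
- move=> A gA f Sf; have [_ /(_ f Sf)[SA LA]] := generated_algebra_Kcont s_gt0 t_gt0 gA.
  by split=> // x y x0 y0; apply/eqP; rewrite subr_eq0; apply/eqP; exact: LA.
Qed.
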